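(* Let $\beta\in(1,2]$, let $X_1,\dots,X_n$ be i.i.d. real random variables with $\mathbb{E}[X_i]=\mu$, $\mathbb{E}|X_i-\mu|^2=\sigma^2$ and $\mathbb{E}|X_i-\mu|^{2\beta}=m_{2\beta}<\infty$, and let $\epsilon\in(0,1/6)$. Let $\psi_1,\psi_2$ be Catoni-type functions as described in the context, with $\psi_1$ satisfying the regularity assumption stated there with constant $M$, and let $f_1,f_2$ be the functions defined in the context. There exists a constant $C=C(m_{2\beta},\sigma,\beta)$ such that, for all $n\ge C[\log(\epsilon^{-1})+1]$, the system $$f_1(\theta,v)=0,\qquad f_2(\theta,v)=0$$ admits a solution $(\hat\theta,\hat v)$ satisfying, with probability at least $1-6\epsilon$: $$|\hat\theta-\mu|\le \sigma\left(1+c_1\left(\frac{\log(\epsilon^{-1})}{n}\right)^{\frac{\beta-1}{\beta}}\right)\sqrt{\frac{2\log(\epsilon^{-1})}{n}},$$ and $$\left(1+c_0\left(\frac{\log(\epsilon^{-1})}{n}\right)^{\frac{\beta-1}{\beta}}\right)^{-\frac12}\sigma\le \hat v\le \left(1-c_0\left(\frac{\log(\epsilon^{-1})}{n}\right)^{\frac{\beta-1}{\beta}}\right)^{-\frac12}\sigma,$$ where $c_0=c_0(m_{2\beta},\sigma,\beta)$ and $c_1=c_1(M,\sigma)$ do not depend on $n$ or $\epsilon$.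
   Context: $\psi_1,\psi_2:\mathbb{R}\to\mathbb{R}$ are continuous non-decreasing functions, each with a root at $0$, satisfying for all $x\in\mathbb{R}$ $$-\log\left(1-x+\tfrac{|x|^2}{2}\right)\le\psi_1(x)\le\log\left(1+x+\tfrac{|x|^2}{2}\right),\qquad -\log\left(1-x+\tfrac{|x|^\beta}{\beta}\right)\le\psi_2(x)\le\log\left(1+x+\tfrac{|x|^\beta}{\beta}\right).$$ Regularity assumption on $\psi_1$: $\psi_1$ is twice differentiable except at finitely many points, and $|\psi_1''(x)|\le M\min\{1,1/x^2\}$ wherever it exists, for some positive constant $M$. Parameters: $\alpha_1=\sqrt{2\log(\epsilon^{-1})/n}$ and $\alpha_2=\left(\log(\epsilon^{-1})/n\right)^{1/\beta}$. For $\theta\in\mathbb{R}$, $v>0$, $$f_1(\theta,v)=\frac1n\sum_{i=1}^n\psi_1\left(\alpha_1\frac{X_i-\theta}{v}\right),\qquad f_2(\theta,v)=\frac1n\sum_{i=1}^n\psi_2\left(\alpha_2\left(\frac{(X_i-\theta)^2}{v^2}-1\right)\right).$$ The notation $C(\cdot)$, $c(\cdot)$ denotes a positive constant depending only on the listed arguments. *)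

(* Defs.v *)
From HB Require Import structures.
From mathcomp Require Import all_boot all_order all_algebra.
From mathcomp Require Import all_classical all_reals all_analysis.
Import Order.TTheory GRing.Theory Num.Theory.
Import numFieldNormedType.Exports.

Set Implicit Arguments.
Unset Strict Implicit.
Unset Printing Implicit Defensive.

Local Open Scope classical_set_scope.
Local Open Scope ring_scope.

(* For 1 < b <= 2 the arguments of both logarithms are positive, so the junk
   value of [ln] on nonpositive reals is never used. *)
Definition catoni_type (R : realType) (b : R) (psi : R -> R) : Prop :=
  [/\ continuous psi,
      {homo psi : x y / x <= y},
      psi 0 = 0 &
      forall x : R,
        - ln (1 - x + `|x| `^ b / b) <= psi x <= ln (1 + x + `|x| `^ b / b)].

(* [derive1 psi] is total, with junk values where [psi] is not derivable; hence the
   derivability requirement on a whole neighbourhood of [x]. *)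
Definition twice_derivable (R : realType) (psi : R -> R) (x : R) : Prop :=
  (\forall y \near x, derivable psi y 1) /\ derivable (derive1 psi) x 1.

(* min{1, 1/x^2}; the case x = 0 is separate because 0^-1 = 0 here, whereas
   1/0 should be read as +oo. *)
Definition min1_invsqr (R : realType) (x : R) : R :=
  if x == 0 then 1 else Num.min 1 (x ^+ 2)^-1.

Definition regular_with (R : realType) (M : R) (psi : R -> R) : Prop :=
  (exists s : seq R, forall x : R, x \notin s -> twice_derivable psi x) /\
  (forall x : R, twice_derivable psi x -> `|derive1n 2 psi x| <= M * min1_invsqr x).

Definition mutually_independent (R : realType) (d : measure_display)
    (T : measurableType d) (P : probability T R) (n : nat)
    (X : 'I_n -> {RV P >-> R}) : Prop :=
  forall (J : {set 'I_n}) (A : 'I_n -> set R),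
    (forall i, measurable (A i)) ->
    P [set w | forall i, i \in J -> A i (X i w)] =
    (\prod_(i in J) P (X i @^-1` A i))%E.

Definition identically_distributed (R : realType) (d : measure_display)
    (T : measurableType d) (P : probability T R) (n : nat)
    (X : 'I_n -> {RV P >-> R}) : Prop :=
  forall (i j : 'I_n) (A : set R), measurable A ->
    distribution P (X i) A = distribution P (X j) A.

Definition iid (R : realType) (d : measure_display)
    (T : measurableType d) (P : probability T R) (n : nat)
    (X : 'I_n -> {RV P >-> R}) : Prop :=
  mutually_independent X /\ identically_distributed X.

(* The measure [P] is unspecified on nonmeasurable sets, so "E holds with
   probability at least p" is witnessed by a measurable subset of E. *)
Definition with_probability_at_least (R : realType) (d : measure_display)
    (T : measurableType d) (P : probability T R) (p : R) (E : set T) : Prop :=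
  exists A : set T, [/\ measurable A, A `<=` E & (p%:E <= P A)%E].

Definition alpha1 (R : realType) (n : nat) (eps : R) : R :=
  Num.sqrt (2 * ln eps^-1 / n%:R).

Definition alpha2 (R : realType) (beta : R) (n : nat) (eps : R) : R :=
  (ln eps^-1 / n%:R) `^ beta^-1.

Definition f1 (R : realType) (psi1 : R -> R) (n : nat) (eps : R)
    (x : 'I_n -> R) (theta v : R) : R :=
  n%:R^-1 * \sum_(i < n) psi1 (alpha1 n eps * ((x i - theta) / v)).

Definition f2 (R : realType) (psi2 : R -> R) (beta : R) (n : nat) (eps : R)
    (x : 'I_n -> R) (theta v : R) : R :=
  n%:R^-1 *
  \sum_(i < n) psi2 (alpha2 beta n eps * ((x i - theta) ^+ 2 / v ^+ 2 - 1)).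

Definition rate (R : realType) (beta : R) (n : nat) (eps : R) : R :=
  (ln eps^-1 / n%:R) `^ ((beta - 1) / beta).

(* Main.v *)
Require Import Defs.
From HB Require Import structures.
From mathcomp Require Import all_boot all_order all_algebra.
From mathcomp Require Import finmap.
From mathcomp Require Import all_classical all_reals all_analysis.
From mathcomp Require Import measurable_realfun simple_functions ring lra.
Import Order.TTheory GRing.Theory Num.Theory.
Import numFieldNormedType.Exports HBNNSimple.

Local Open Scope classical_set_scope.
Local Open Scope ring_scope.

(** Write [r] for [ln eps^-1 / n] and [rho] for the rate [r `^ ((beta - 1) / beta)],
    so that [alpha1 ^+ 2 = 2 * r] and [alpha2 * rho = alpha2 `^ beta = r].

    Exponential inequality.  The upper envelopes say that [expR (psi t)] is at most
    an explicit function of [t].  In each use below that function is majorized by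
    [c0 + c1 * y + c2 * y ^+ 2 + c3 * `|y| `^ (2 * beta)] with [y = x - mu], whose
    expectation is given exactly by the moment hypotheses.  Expectations of products
    factorize by independence, so Markov's inequality makes a sum of scores
    nonpositive outside an event of probability [eps] as soon as
    [n * (expectation - 1) + ln eps^-1 <= 0] ([chernoff_moment_poly]).  The lower
    envelopes are the upper ones for [x |-> - psi (- x)].

    Existence of a root.  The score [f1] is nonincreasing in [theta], which suffices
    for a planar intermediate value theorem ([miranda_monotone]): a common zero
    exists in the rectangle [`|theta - mu| <= kappa * sigma], [v0 <= v <= v1] when
    [f1] and [f2] have the right signs on its vertical and horizontal sides.  Each
    side is a segment, and one event has to fix the sign on all of it.

    - On [v = v0] and [v = v1], the square [(x - theta) ^+ 2] lies between
      [(1 - kappa) * (y ^+ 2 - kappa * sigma ^+ 2)] and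
      [(1 + kappa) * (y ^+ 2 + kappa * sigma ^+ 2)] for every [theta] of the side, so
      that monotonicity of [psi2] reduces the side to one sum.

    - On [theta = mu +- kappa * sigma], the ratio [lam = v / sigma] ranges over an
      interval of half-width [delta = c0 * rho], where [c0] grows with the moment [m],
      while [kappa] may exceed its leading term [alpha1] only by a relative amount
      [c1 * rho] in which [m] does not enter.  A crude bound would lose a multiple of
      [delta].  The way out is to rescale the score: [ln (1 + t + t ^+ 2 / 2)]
      differs from [t] by a cubic term only, hence [lam * psi1 (s / lam)] depends on
      [lam] only to higher order.  Its exponential is bounded, for all these [lam]
      at once, by [1 + s + s ^+ 2 / 2] plus a multiple of
      [delta ^+ 2 * s ^+ 2 + `|s| `^ (2 * beta)] ([catoni_scaled_le]), and the
      expectation of this error is negligible against [r * rho] once [n] is large in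
      terms of [m], [sigma] and [beta].  Therefore [c1] can be the constant 1.

    The four sides cost four events of probability [eps]. *)

(** * Independence and the Chernoff bound *)
Section independence.
Context (R : realType) d (T : measurableType d) (P : probability T R).

(** The hypothesis on [H] is independence of [H] and [X] in integrated form, with
    [c] in the role of the expectation of [H]; this is the case of simple functions
    in the extension from indicators to nonnegative measurable functions. *)
Lemma ge0_integral_indep_sum (X : {RV P >-> R}) (H : T -> R) (c : R) (k : nat)
    (s : 'I_k -> R) (A : 'I_k -> set R) :
  measurable_fun setT H -> (forall w, 0 <= H w) ->
  (forall i, 0 <= s i) -> (forall i, measurable (A i)) ->
  (forall B : set R, measurable B ->
     (\int[P]_w (H w * \1_B (X w))%:E = c%:E * P (X @^-1` B))%E) ->
  (\int[P]_w (H w * (\sum_(i < k) s i * \1_(A i) (X w)))%:E =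
   c%:E * \int[P]_w (\sum_(i < k) s i * \1_(A i) (X w))%:E)%E.
Proof.
move=> mH H0 s0 mA HA.
have m1 i : measurable_fun setT (fun w => \1_(A i) (X w) : R).
  by apply: measurableT_comp => //; exact: measurable_indic.
have m2 i : measurable_fun setT (fun w => s i * \1_(A i) (X w) : R).
  exact: measurable_funM.
rewrite (_ : (fun w => (H w * (\sum_(i < k) s i * \1_(A i) (X w)))%:E) =
   (fun w => \sum_(i < k) (s i)%:E * (H w * \1_(A i) (X w))%:E)%E); last first.
  apply/funext => w; rewrite mulr_sumr -sumEFin; apply: eq_bigr => i _.
  by rewrite -EFinM mulrCA.
rewrite (_ : (fun w => (\sum_(i < k) s i * \1_(A i) (X w))%:E) =
   (fun w => \sum_(i < k) (s i)%:E * (\1_(A i) (X w))%:E)%E); last first.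
  by apply/funext => w; rewrite -sumEFin.
have ind0 (B : set R) x : 0 <= \1_B x :> R by rewrite indicE.
rewrite !ge0_integral_sum//; last first.
- by move=> i w _; rewrite -!EFinM lee_fin !mulr_ge0.
- move=> i; apply: emeasurable_funM; first exact: measurable_cst.
  by apply/measurable_EFinP; apply: measurable_funM.
- by move=> i w _; rewrite -!EFinM lee_fin mulr_ge0.
- move=> i; apply: emeasurable_funM; first exact: measurable_cst.
  exact/measurable_EFinP.
rewrite ge0_sume_distrr; last first.
  by move=> i _; apply: integral_ge0 => w _; rewrite -!EFinM lee_fin mulr_ge0.
apply: eq_bigr => i _.
rewrite !ge0_integralZl_EFin//; last first.
- by apply/measurable_EFinP; first [exact: m1 | exact: measurable_funM].
- by move=> w _; rewrite lee_fin mulr_ge0.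
- by apply/measurable_EFinP; first [exact: m1 | exact: measurable_funM].
rewrite HA// muleCA; congr (_ * (_ * _))%E.
rewrite (_ : (fun w => (\1_(A i) (X w))%:E) = (fun w => (\1_(X @^-1` A i) w)%:E))//.
rewrite integral_indic// ?setIT// -[X in measurable X]setTI.
exact: measurable_funP.
Qed.

(** By monotone convergence along simple approximations of [f]. *)
Lemma ge0_integral_indep (X : {RV P >-> R}) (H : T -> R) (f : R -> R) (c : R) :
  measurable_fun setT H -> (forall w, 0 <= H w) ->
  measurable_fun setT f -> (forall x, 0 <= f x) ->
  (forall B : set R, measurable B ->
     (\int[P]_w (H w * \1_B (X w))%:E = c%:E * P (X @^-1` B))%E) ->
  (\int[P]_w (H w * f (X w))%:E = c%:E * \int[P]_w (f (X w))%:E)%E.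
Proof.
move=> mH H0 mf f0 HB.
have mf' : measurable_fun setT (EFin \o f) by exact/measurable_EFinP.
pose h := nnsfun_approx measurableT mf'.
have hX n : measurable_fun setT (fun w => h n (X w)).
  exact: measurableT_comp.
have hnd (w : T) : {homo (fun n => h n (X w)) : m n / (m <= n)%N >-> m <= n}.
  by move=> m n mn; exact: (lefP _ _ (nd_nnsfun_approx measurableT mf' mn)).
have hcvg w : (h n (X w))%:E @[n --> \oo] --> (f (X w))%:E.
  by apply: cvg_nnsfun_approx => // x _; rewrite lee_fin.


have hcvgX : (\int[P]_w (h n (X w))%:E @[n --> \oo] --> \int[P]_w (f (X w))%:E)%E.
  have -> : (\int[P]_w (f (X w))%:E = \int[P]_w limn (fun n => (h n (X w))%:E))%E.
    by apply: eq_integral => w _; exact/esym/cvg_lim.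
  apply: (@cvg_monotone_convergence _ _ _ P setT measurableT
    (fun n w => (h n (X w))%:E)) => //.
  - by move=> n; exact/measurable_EFinP.
  - by move=> n w _; rewrite lee_fin.
  - by move=> w _ m n mn; rewrite lee_fin hnd.
have hcvgH : (\int[P]_w (H w * h n (X w))%:E @[n --> \oo] -->
    \int[P]_w (H w * f (X w))%:E)%E.
  have -> : (\int[P]_w (H w * f (X w))%:E =
      \int[P]_w limn (fun n => (H w * h n (X w))%:E))%E.
    apply: eq_integral => w _; apply/esym/cvg_lim => //.
    under eq_fun do rewrite EFinM.
    by rewrite EFinM; apply: cvgeZl.
  apply: (@cvg_monotone_convergence _ _ _ P setT measurableT
    (fun n w => (H w * h n (X w))%:E)) => //.
  - by move=> n; apply/measurable_EFinP; exact: measurable_funM.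
  - by move=> n w _; rewrite lee_fin mulr_ge0.
  - by move=> w _ m n mn; rewrite lee_fin ler_wpM2l// hnd.
apply: cvg_unique hcvgH _ => //.
rewrite (_ : (fun n => \int[P]_w (H w * h n (X w))%:E) =
   (fun n => c%:E * \int[P]_w (h n (X w))%:E))%E; first exact: cvgeZl.
apply/funext => n.
have hE w : h n (X w) = \sum_(i < #|`fset_set (range (h n))|)
   (fset_set (range (h n)))`_i *
   \1_(h n @^-1` [set (fset_set (range (h n)))`_i]) (X w) := fimfunEord (h n) (X w).
under eq_integral do rewrite hE.
under [in RHS]eq_integral do rewrite hE.
apply: ge0_integral_indep_sum => // i.
have : (fset_set (range (h n)))`_i \in fset_set (range (h n)) by exact: mem_nth.
by rewrite in_fset_set// inE => -[x _ <-].
Qed.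


(** Independence is the product rule for indicators.  The indicators are replaced by
    the functions [f i] one index at a time, each replacement being an instance of
    [ge0_integral_indep] in which [H] is the product of all other factors. *)
Lemma expectation_prod_indep n (X : 'I_n -> {RV P >-> R})
    (f : 'I_n -> R -> R) (e : 'I_n -> R) :
  mutually_independent X ->
  (forall i, measurable_fun setT (f i)) -> (forall i x, 0 <= f i x) ->
  (forall i, \int[P]_w (f i (X i w))%:E = (e i)%:E)%E ->
  (\int[P]_w (\prod_(i < n) f i (X i w))%:E = (\prod_(i < n) e i)%:E)%E.
Proof.
move=> indX mf f0 fe.
have ind0 (B : set R) x : 0 <= \1_B x :> R by rewrite indicE.
have mX i (B : set R) : measurable B -> measurable (X i @^-1` B).
  by move=> mB; rewrite -[X in measurable X]setTI; exact: measurable_funP.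
(* After [k] replacements: functions at the indices below [k], indicators above. *)
have mixed k : (k <= n)%N -> forall A : 'I_n -> set R, (forall i, measurable (A i)) ->
  (\int[P]_w (\prod_(i < n) if (i < k)%N then f i (X i w) else \1_(A i) (X i w))%:E =
  (\prod_(i < n) if (i < k)%N then e i else fine (P (X i @^-1` A i)))%:E)%E.
  elim: k => [_|k IH kn] A mA.
    pose E := [set w | forall i, i \in [set: 'I_n]%SET -> A i (X i w)].
    rewrite (_ : (fun w => _) = (fun w => (\1_E w)%:E)); last first.
      apply/funext => w; congr EFin; rewrite /= indicE.
      case: (boolP (w \in E)) => [|].
        rewrite inE /= => h; rewrite big1// => i _.
        by rewrite indicE mem_set//; apply: h; rewrite inE.
      move/negP; rewrite inE /= => /existsNP[i /not_implyP[_ ni]].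
      by rewrite (bigD1 i)//= indicE memNset// mul0r.
    rewrite integral_indic//; last first.
      rewrite (_ : E = \bigcap_(i in [set: 'I_n]) (X i @^-1` A i)).
        by apply: fin_bigcap_measurable => // i _; exact: mX.
      apply/seteqP; split => w /= h i; first by move=> _; apply: h; rewrite inE.
      by move=> _; exact: h.
    rewrite setIT; apply: etrans (indX [set: 'I_n]%SET A mA) _.
    rewrite (big_morph EFin (@EFinM R) (erefl 1%E)).
    apply: eq_big => [i|i _]; first by rewrite inE.
    by rewrite fineK// fin_num_measure//; exact: mX.
  pose j := Ordinal kn.
  have jk (i : 'I_n) : i != j -> (i < k.+1)%N = (i < k)%N.
    by rewrite ltnS leq_eqVlt -(inj_eq val_inj)/= => /negbTE ->.
  pose F (w : T) (i : 'I_n) := if (i < k)%N then f i (X i w) else \1_(A i) (X i w).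
  pose c (i : 'I_n) := if (i < k)%N then e i else fine (P (X i @^-1` A i)).
  rewrite (_ : (fun w => _) =
      (fun w => ((\prod_(i < n | i != j) F w i) * f j (X j w))%:E)); last first.
    apply/funext => w; rewrite (bigD1 j)//= ltnSn mulrC; congr (_ * _)%:E.
    by apply: eq_bigr => i ij; rewrite jk.
  have mF : measurable_fun setT (fun w => \prod_(i < n | i != j) F w i).
    have -> : (fun w => \prod_(i < n | i != j) F w i) =
              (fun w => \prod_(i < n) if i != j then F w i else 1).
      by apply/funext => w; rewrite big_mkcond.
    apply: measurable_prod => i _; rewrite /F; case: (i != j) => //; case: (i < k)%N.
      exact: measurableT_comp.
    by apply: measurableT_comp => //; exact: measurable_indic.
  have F0 w : 0 <= \prod_(i < n | i != j) F w i.
    by apply: prodr_ge0 => i _; rewrite /F; case: ifP.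
  have indF (B : set R) : measurable B ->
      (\int[P]_w ((\prod_(i < n | i != j) F w i) * \1_B (X j w))%:E =
       (\prod_(i < n | i != j) c i)%:E * P (X j @^-1` B))%E.
    move=> mB; pose A' i := if i == j then B else A i.
    have mA' i : measurable (A' i) by rewrite /A'; case: ifP.
    have := IH (ltnW kn) _ mA'.
    rewrite (_ : (fun w => (\prod_(i < n) _)%:E) =
        (fun w => ((\prod_(i < n | i != j) F w i) * \1_B (X j w))%:E)).
      move=> ->; rewrite (bigD1 j)//= ltnn mulrC EFinM /A' eqxx fineK; last first.
        by rewrite fin_num_measure//; exact: mX.
      congr (_%:E * _)%E; apply: eq_bigr => i /negbTE ij.
      by rewrite /c ij.
    apply/funext => w; rewrite (bigD1 j)//= ltnn mulrC /A' eqxx; congr (_ * _)%:E.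
    by apply: eq_bigr => i /negbTE ij; rewrite /F ij.
  apply: etrans (ge0_integral_indep _ _ _ _ mF F0 (mf j) (f0 j) indF) _.
  rewrite fe -EFinM [in RHS](bigD1 j)//= ltnSn mulrC; congr (_ * _)%:E.
  by apply: eq_bigr => i ij; rewrite jk.
have := mixed n (leqnn n) (fun=> setT) (fun=> measurableT).
under eq_integral do under eq_bigr => i _ do rewrite ltn_ord.
by under eq_bigr => i _ do rewrite ltn_ord.
Qed.

(** Markov's inequality for the product: its expectation is at most
    [(1 + b) ^+ n <= expR (n * b) <= eps]. *)
Lemma chernoff_prod n (X : 'I_n -> {RV P >-> R}) (g : R -> R) (e : 'I_n -> R)
    (b eps : R) :
  mutually_independent X ->
  measurable_fun setT g -> (forall x, 0 <= g x) ->
  (forall i, \int[P]_w (g (X i w))%:E = (e i)%:E)%E ->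
  (forall i, e i <= 1 + b) -> 0 < eps -> n%:R * b + ln eps^-1 <= 0 ->
  exists A : set T, [/\ measurable A, ((1 - eps)%:E <= P A)%E &
    forall w, A w -> \prod_(i < n) g (X i w) < 1].
Proof.
move=> indX mg g0 ge eb eps0 nb.
pose S w := \prod_(i < n) g (X i w).
have mS : measurable_fun setT S.
  by apply: measurable_prod => i _; exact: measurableT_comp.
have S0 w : 0 <= S w by exact: prodr_ge0.
pose B := [set w | 1 <= S w].
have mB : measurable B.
  rewrite (_ : B = setT `&` S @^-1` `[1, +oo[); first exact: mS.
  by apply/seteqP; split => w /=; rewrite /B /= in_itv/= andbT; [move=> ?; split|case].
have PB : (P B <= eps%:E)%E.
  have -> : P B = (\int[P]_w (\1_B w)%:E)%E by rewrite integral_indic// setIT.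
  apply: (@le_trans _ _ (\int[P]_w (S w)%:E)%E).
    apply: ge0_le_integral => //.
    - exact/measurable_EFinP/measurable_indic.
    - exact/measurable_EFinP.
    - move=> w _; rewrite lee_fin indicE; case: (boolP (w \in B)) => [|_]; last exact: S0.
      by rewrite inE.
  rewrite (expectation_prod_indep n X (fun=> g) e)// lee_fin.
  have e0 i : 0 <= e i.
    by rewrite -lee_fin -ge; apply: integral_ge0 => w _; rewrite lee_fin.
  apply: (@le_trans _ _ (\prod_(i < n) expR b)).
    apply: ler_prod => i _; rewrite e0/=.
    by rewrite (le_trans (eb i))// expR_ge1Dx.
  rewrite prodr_const card_ord -expRM_natl -[leRHS]lnK ?posrE//.
  rewrite ler_expR mulr_natl; move: nb; rewrite lnV ?posrE// -mulr_natl; lra.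
exists (~` B); split.
- exact: measurableC.
- rewrite probability_setC// EFinB leeB//.
- by move=> w /= /negP; rewrite -ltNge.
Qed.

End independence.

Section moments.
Context (R : realType) d (T : measurableType d) (P : probability T R).

Lemma integral_moment_poly (X : {RV P >-> R}) (mu s2 q m c0 c1 c2 c3 : R) :
  ('E_P[X] = mu%:E)%E ->
  ('E_P[fun w : T => (`|X w - mu| ^+ 2)%R] = s2%:E)%E ->
  ('E_P[fun w : T => (`|X w - mu| `^ q)%R] = m%:E)%E ->
  (\int[P]_w (c0 + c1 * (X w - mu) + c2 * (X w - mu) ^+ 2 +
              c3 * `|X w - mu| `^ q)%:E = (c0 + c2 * s2 + c3 * m)%:E)%E.
Proof.
rewrite unlock => EX E2 Eq.
have mY : measurable_fun setT (fun w => X w - mu).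
  by apply: measurable_funB.
have i2 : P.-integrable setT (fun w => ((X w - mu) ^+ 2)%:E).
  apply/integrableP; split; first by apply/measurable_EFinP; exact: measurable_funX.
  rewrite (_ : (fun w => _) = (fun w => (`|X w - mu| ^+ 2)%:E)); first by rewrite E2 ltry.
  by apply/funext => w; rewrite /= ger0_norm ?sqr_ge0// real_normK// num_real.
have iq : P.-integrable setT (fun w => (`|X w - mu| `^ q)%:E).
  apply/integrableP; split.
    apply/measurable_EFinP; apply: (measurableT_comp (measurable_powR q)).
    exact: measurableT_comp.
  rewrite (_ : (fun w => _) = (fun w => (`|X w - mu| `^ q)%:E)); first by rewrite Eq ltry.
  by apply/funext => w; rewrite /= ger0_norm// powR_ge0.
have ic (c : R) : P.-integrable setT (fun w : T => c%:E).
  by apply: finite_measure_integrable_cst.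
(* A first absolute moment is dominated by 1 plus the second one. *)
have i1 : P.-integrable setT (fun w => (X w - mu)%:E).
  apply: (@le_integrable _ _ _ P setT measurableT _ (fun w => (1 + (X w - mu) ^+ 2)%:E)).
  - exact/measurable_EFinP.
  - move=> w _; rewrite /= lee_fin [leRHS]ger0_norm ?addr_ge0 ?sqr_ge0//.
    rewrite -(real_normK (num_real (X w - mu))).
    have := sqr_ge0 (2 * `|X w - mu| - 1); nra.
  - under eq_fun do rewrite EFinD.
    exact: integrableD.
have E1 : (\int[P]_w (X w - mu)%:E = 0)%E.
  have iX : P.-integrable setT (fun w => (X w)%:E).
    rewrite (_ : (fun w => _) = (fun w => (X w - mu)%:E + mu%:E)%E).
      exact: integrableD.
    by apply/funext => w; rewrite -EFinD subrK.
  under eq_integral do rewrite EFinB.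
  rewrite integralB// EX integral_cst//= probability_setT mule1 subee//.
have iZ (c : R) (f : T -> R) : P.-integrable setT (EFin \o f) ->
    P.-integrable setT (fun w => (c * f w)%:E).
  by move=> If; under eq_fun do rewrite EFinM; exact: integrableZl.
have eZ (c : R) (f : T -> R) : P.-integrable setT (EFin \o f) ->
    (\int[P]_w (c * f w)%:E = c%:E * \int[P]_w (f w)%:E)%E.
  by move=> If; under eq_integral do rewrite EFinM; rewrite integralZl.
have eD (f g : T -> R) : P.-integrable setT (EFin \o f) ->
    P.-integrable setT (EFin \o g) ->
    (\int[P]_w (f w + g w)%:E = \int[P]_w (f w)%:E + \int[P]_w (g w)%:E)%E.
  by move=> If Ig; under eq_integral do rewrite EFinD; rewrite integralD.
have iD (f g : T -> R) : P.-integrable setT (EFin \o f) ->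
    P.-integrable setT (EFin \o g) ->
    P.-integrable setT (EFin \o (fun w => f w + g w)).
  move=> If Ig; rewrite (_ : _ \o _ = (fun w => (f w)%:E + (g w)%:E)%E)//.
  exact: integrableD.
have E2' : (\int[P]_w ((X w - mu) ^+ 2)%:E = s2%:E)%E.
  by rewrite -E2; apply: eq_integral => w _; rewrite real_normK// num_real.
rewrite (eD (fun w => c0 + c1 * (X w - mu) + c2 * (X w - mu) ^+ 2)); last 2 first.
- by apply: (iD); [apply: iD; [exact: ic|exact: iZ]|exact: iZ].
- exact: iZ.
rewrite (eD (fun w => c0 + c1 * (X w - mu))); last 2 first.
- by apply: iD; [exact: ic|exact: iZ].
- exact: iZ.
rewrite (eD (fun w => c0)); last 2 first.
- exact: ic.
- exact: iZ.
rewrite integral_cst//= probability_setT mule1.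
rewrite (eZ c1 (fun w => X w - mu))// (eZ c2 (fun w => (X w - mu) ^+ 2))//.
rewrite (eZ c3 (fun w => `|X w - mu| `^ q))// E1 E2' Eq mule0 adde0.
by rewrite -!EFinM -!EFinD.
Qed.

End moments.

Section tail_bound.
Context (R : realType) d (T : measurableType d) (P : probability T R).

(** The event [A] is chosen before the family [phi].  This order of quantifiers is
    what makes one event serve a whole range of scale parameters: every family of
    scores with the same majorant has a nonpositive sum on [A]. *)
Lemma chernoff_moment_poly n (X : 'I_n -> {RV P >-> R})
    (mu s2 q m c0 c1 c2 c3 eps : R) :
  mutually_independent X ->
  (forall i, 'E_P[X i] = mu%:E)%E ->
  (forall i, 'E_P[fun w : T => (`|X i w - mu| ^+ 2)%R] = s2%:E)%E ->
  (forall i, 'E_P[fun w : T => (`|X i w - mu| `^ q)%R] = m%:E)%E ->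
  (forall y : R, 0 <= c0 + c1 * y + c2 * y ^+ 2 + c3 * `|y| `^ q) ->
  0 < eps -> n%:R * (c0 + c2 * s2 + c3 * m - 1) + ln eps^-1 <= 0 ->
  exists A : set T, [/\ measurable A, ((1 - eps)%:E <= P A)%E &
    forall w, A w -> forall phi : 'I_n -> R,
    (forall i, let y := X i w - mu in
       expR (phi i) <= c0 + c1 * y + c2 * y ^+ 2 + c3 * `|y| `^ q) ->
    \sum_(i < n) phi i <= 0].
Proof.
move=> indX EX E2 Eq g0 eps0 nb.
pose g (x : R) : R := c0 + c1 * (x - mu) + c2 * (x - mu) ^+ 2 + c3 * `|x - mu| `^ q.
have mY : measurable_fun setT (fun x : R => x - mu) by apply: measurable_funB.
have mg : measurable_fun setT g.
  apply: measurable_funD.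
    apply: measurable_funD; first by apply: measurable_funD => //; apply: measurable_funM.
    by apply: measurable_funM => //; exact: measurable_funX.
  apply: measurable_funM => //.
  apply: (measurableT_comp (measurable_powR q)).
  exact: measurableT_comp.
have ge i : (\int[P]_w (g (X i w))%:E = (c0 + c2 * s2 + c3 * m)%:E)%E.
  exact: integral_moment_poly.
have ge1 (i : 'I_n) : c0 + c2 * s2 + c3 * m <= 1 + (c0 + c2 * s2 + c3 * m - 1).
  by rewrite [leRHS]addrC subrK.
have [A [mA PA hA]] := chernoff_prod R d T P n X g (fun=> c0 + c2 * s2 + c3 * m)
  (c0 + c2 * s2 + c3 * m - 1) eps indX mg (fun x => g0 _) ge
  ge1 eps0 nb.
exists A; split => // w Aw phi hphi.
rewrite -expR_le1 expR_sum ltW// (le_lt_trans _ (hA w Aw))//.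
by apply: ler_prod => i _; rewrite expR_ge0/=; exact: hphi.
Qed.

End tail_bound.


(** * Zeros of the system *)

Section zero_of_system.
Context (R : realType).

Lemma exists_root_sign_change (F : R -> R) (a b : R) :
  a <= b -> continuous F -> 0 <= F a -> F b <= 0 ->
  exists2 x, a <= x <= b & F x = 0.
Proof.
move=> ab cF Fa Fb.
have [x xab Fx] : exists2 x, x \in `[a, b] & F x = 0.
  apply: IVT => //; first exact: continuous_subspaceT.
  by rewrite ge_min le_max Fa Fb orbT.
by exists x => //; move: xab; rewrite in_itv.
Qed.

(** Poincare-Miranda in the plane when the first function is monotone in the first
    variable.  The levels [y] at which some zero of [F (_, y)] has [0 <= G] form a
    closed set, as do those at which some zero has [G <= 0]; they cover the connected
    segment [[c, d]], hence share a level.  There the zeros of [F (_, y)] form an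
    interval by monotonicity, and [G] vanishes on it by the intermediate value
    theorem. *)
Lemma miranda_monotone (F G : R * R -> R) (a b c d : R) :
  a <= b -> c <= d -> continuous F -> continuous G ->
  (forall x x' y, c <= y <= d -> x <= x' -> F (x', y) <= F (x, y)) ->
  (forall y, c <= y <= d -> 0 <= F (a, y)) ->
  (forall y, c <= y <= d -> F (b, y) <= 0) ->
  (forall x, a <= x <= b -> 0 <= G (x, c)) ->
  (forall x, a <= x <= b -> G (x, d) <= 0) ->
  exists x y, [/\ a <= x <= b, c <= y <= d, F (x, y) = 0 & G (x, y) = 0].
Proof.
move=> ab cd cF cG Fdec Fa Fb Gc Gd.
have cst1 (y : R) : continuous (fun x : R => (x, y)).
  move=> x; apply: (@cvg_pair _ _ _ (nbhs (x : R)) (nbhs (x : R)) (nbhs (y : R))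
    _ _ _ id (fun=> y)); [exact: cvg_id|exact: cvg_cst].
have rect : compact (`[a, b] `*` `[c, d] : set (R * R)).
  by apply: compact_setX; exact: segment_compact.
(* Projection to the second coordinate of a compact set, hence closed. *)
pose slice (Z : set R) := [set y | exists2 x, a <= x <= b &
  [/\ c <= y <= d, F (x, y) = 0 & Z (G (x, y))]].
have slice_closed Z : closed Z -> closed (slice Z).
  move=> cZ; apply: compact_closed; first exact: norm_hausdorff.
  have -> : slice Z =
     snd @` ((`[a, b] `*` `[c, d]) `&` (F @^-1` [set x | x = 0] `&` G @^-1` Z)).
    apply/seteqP; split => y /=.
      move=> [x xab [ycd F0 ZG]]; by exists (x, y).
    move=> [[x y']] /= [[+ +] [F0 ZG]] <-; rewrite !in_itv /= => xab ycd.
    by exists x.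
  apply: continuous_compact.
    by apply: continuous_subspaceT => p; exact: cvg_snd.
  apply: compact_closedI => //.
  apply: closedI.
    by apply: preimage_closed; [move=> p _; exact: cF|exact: closed_eq].
  by apply: preimage_closed cZ => p _; exact: cG.
have rootF y : c <= y <= d -> exists2 x, a <= x <= b & F (x, y) = 0.
  move=> ycd; apply: (exists_root_sign_change (fun x => F (x, y)) a b ab _
    (Fa y ycd) (Fb y ycd)).
  by move=> x; apply: continuous_comp; [exact: cst1|exact: cF].
pose S := slice [set x | 0 <= x]; pose N := slice [set x | x <= 0].
have cS : closed S by apply: slice_closed; exact: closed_ge.
have cN : closed N by apply: slice_closed; exact: closed_le.
have Sc : S c.
  have ccd : c <= c <= d by rewrite lexx.
  by have [x xab Fx] := rootF c ccd; exists x => //; split => //=; exact: Gc.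
have Nd : N d.
  have ccd : c <= d <= d by rewrite lexx andbT.
  by have [x xab Fx] := rootF d ccd; exists x => //; split => //=; exact: Gd.
have [y [x1 x1ab [ycd Fx1 Gx1]] [x2 x2ab [_ Fx2 Gx2]]] : exists2 y, S y & N y.
  apply: contrapT => SN.
  have SE : S = [set` `[c, d]].
    have conn : connected [set` `[c, d]] := @segment_connected R c d.
    apply: (conn S).
    - by exists c.
    - exists (~` N); first exact: closed_openC.
      apply/seteqP; split => y /=.
        move=> Sy; split; last by move=> Ny; apply: SN; exists y.
        by case: Sy => x _ [ycd _ _]; rewrite in_itv.
      rewrite in_itv /= => -[ycd Ny]; have [x xab Fx] := rootF y ycd.
      exists x => //; split => //=.
      have [//|G0] := leP 0 (G (x, y)).
      by exfalso; apply: Ny; exists x => //; split => //=; exact: ltW.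
    - exists S => //; apply/seteqP; split => y /=; last by case.
      by move=> Sy; split => //; case: Sy => x _ [ycd _ _]; rewrite in_itv.
  apply: SN; exists d => //; rewrite SE /= in_itv /= lexx andbT.
  by case: Nd => ? _ [/andP[]].
have F0 x : Num.min x1 x2 <= x <= Num.max x1 x2 -> F (x, y) = 0.
  move=> /andP[xm xM]; apply/eqP; rewrite eq_le; apply/andP; split.
    rewrite (le_trans (Fdec _ _ y ycd xm))//.
    by case: (leP x1 x2) => _; rewrite ?Fx1 ?Fx2.
  rewrite (le_trans _ (Fdec _ _ y ycd xM))//.
  by case: (leP x1 x2) => _; rewrite ?Fx1 ?Fx2.
have cGy : continuous (fun x => G (x, y)).
  by move=> x; apply: continuous_comp; [exact: cst1|exact: cG].
have xmM : Num.min x1 x2 <= Num.max x1 x2 by rewrite le_max ge_min lexx.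
have [x xm Gx] : exists2 x, x \in `[Num.min x1 x2, Num.max x1 x2] & G (x, y) = 0.
  apply: (IVT (f := fun x => G (x, y)) xmM); first exact: continuous_subspaceT.
  case: (leP x1 x2) => _ /=; rewrite ge_min le_max.
    by rewrite Gx1 Gx2 !orbT.
  by rewrite Gx1 Gx2 ?orbT.
move: xm; rewrite in_itv /= => xm.
exists x, y; split => //; last exact: F0.
move: xm x1ab x2ab => /andP[]; rewrite ge_min le_max => /orP xm /orP xM.
move=> /andP[? ?] /andP[? ?]; apply/andP; split.
  by case: xm; apply: le_trans.
by case: xM => /le_trans; apply.
Qed.

End zero_of_system.

Section system_root.
Context (R : realType).

(** [miranda_monotone] is applied in the variable [u = v^-1], in which both scores are
    continuous on the whole plane; the sign of [f2] is reversed because inversion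
    exchanges the ends of the segment. *)
Lemma exists_system_root (psi1 psi2 : R -> R) (beta eps : R) (n : nat) (x : 'I_n -> R)
    (t0 t1 v0 v1 : R) :
  continuous psi1 -> continuous psi2 -> {homo psi1 : x y / x <= y} ->
  t0 <= t1 -> 0 < v0 -> v0 <= v1 ->
  (forall v, v0 <= v <= v1 -> 0 <= f1 psi1 eps x t0 v) ->
  (forall v, v0 <= v <= v1 -> f1 psi1 eps x t1 v <= 0) ->
  (forall t, t0 <= t <= t1 -> 0 <= f2 psi2 beta eps x t v0) ->
  (forall t, t0 <= t <= t1 -> f2 psi2 beta eps x t v1 <= 0) ->
  exists t v, [/\ t0 <= t <= t1, v0 <= v <= v1,
    f1 psi1 eps x t v = 0 & f2 psi2 beta eps x t v = 0].
Proof.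
move=> c1 c2 mono t01 v00 v01 h1 h2 h3 h4.
have v10 : 0 < v1 by exact: lt_le_trans v01.
pose a := alpha1 n eps; pose al := alpha2 beta n eps.
pose F (p : R * R) : R := n%:R^-1 * \sum_(i < n) psi1 (a * ((x i - p.1) * p.2)).
pose G (p : R * R) : R :=
  - (n%:R^-1 * \sum_(i < n) psi2 (al * ((x i - p.1) ^+ 2 * p.2 ^+ 2 - 1))).
have FE t u : F (t, u) = f1 psi1 eps x t u^-1.
  by rewrite /F /f1; congr (_ * _); apply: eq_bigr => i _; rewrite invrK.
have GE t u : G (t, u) = - f2 psi2 beta eps x t u^-1.
  by rewrite /G /f2; congr (- (_ * _)); apply: eq_bigr => i _; rewrite exprVn invrK.
have cfst i : continuous (fun p : R * R => x i - p.1).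
  by move=> p; apply: cvgB; [exact: cvg_cst|exact: cvg_fst].
have csnd : continuous (fun p : R * R => p.2) by move=> p; exact: cvg_snd.
have csum (f : 'I_n -> R * R -> R) : (forall i, continuous (f i)) ->
    continuous (fun p => \sum_(i < n) f i p).
  by move=> cf; apply: continuous_big => //; exact: add_continuous.
have ccst (c : R) : continuous (fun p : R * R => c) by move=> p; exact: cvg_cst.
have cM (f g : R * R -> R) : continuous f -> continuous g ->
    continuous (fun p => f p * g p).
  by move=> cf cg p; apply: cvgM; [exact: cf|exact: cg].
have cB (f g : R * R -> R) : continuous f -> continuous g ->
    continuous (fun p => f p - g p).
  by move=> cf cg p; apply: cvgB; [exact: cf|exact: cg].
have cF : continuous F.
  apply: (cM); first exact: ccst.
  apply: csum => i p.
  apply: (@continuous_comp _ _ _ (fun p : R * R => a * ((x i - p.1) * p.2)) psi1);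
    last exact: c1.
  by apply: (cM); [exact: ccst|apply: (cM); [exact: cfst|exact: csnd]].
have cG : continuous G.
  move=> p; apply: cvgN; move: p; apply: (cM); first exact: ccst.
  apply: csum => i p.
  apply: (@continuous_comp _ _ _
    (fun p : R * R => al * ((x i - p.1) ^+ 2 * p.2 ^+ 2 - 1)) psi2); last exact: c2.
  apply: (cM); first exact: ccst.
  apply: cB; last exact: ccst.
  by apply: (cM); apply: (cM); (exact: cfst || exact: csnd).
have inv_mem u : v1^-1 <= u <= v0^-1 -> v0 <= u^-1 <= v1.
  move=> /andP[u1 u0]; have up : 0 < u by rewrite (lt_le_trans _ u1)// invr_gt0.
  by rewrite -[v0]invrK lef_pV2 ?posrE ?invr_gt0// u0 /= invf_ple ?posrE.
have [t [u [tI uI F0 G0]]] : exists t u, [/\ t0 <= t <= t1, v1^-1 <= u <= v0^-1,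
    F (t, u) = 0 & G (t, u) = 0].
  apply: miranda_monotone => //.
  - by rewrite lef_pV2 ?posrE.
  - move=> s s' u /andP[u1 _] ss'.
    have up : 0 < u by rewrite (lt_le_trans _ u1)// invr_gt0.
    rewrite ler_wpM2l ?invr_ge0 ?ler0n//; apply: ler_sum => i _; apply: mono.
    by rewrite ler_wpM2l ?sqrtr_ge0// ler_wpM2r ?(ltW up)// lerD2l lerN2.
  - by move=> u /inv_mem uI; rewrite FE h1.
  - by move=> u /inv_mem uI; rewrite FE h2.
  - by move=> t tI; rewrite GE invrK oppr_ge0 h4.
  - by move=> t tI; rewrite GE invrK oppr_le0 h3.
exists t, u^-1; split => //; first exact: inv_mem.
- by rewrite -FE.
- by apply/eqP; rewrite -oppr_eq0 -GE G0.
Qed.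

End system_root.

(** * The scaled score *)

Section scaled_log.
Context (R : realType).
Implicit Types t x lam delta : R.

Lemma quad_ge t : 2^-1 <= 1 + t + t ^+ 2 / 2.
Proof. have := sqr_ge0 (t + 1); rewrite !expr2; lra. Qed.

Lemma quad_gt0 t : 0 < 1 + t + t ^+ 2 / 2.
Proof. by rewrite (lt_le_trans _ (quad_ge t)). Qed.

(** The quadratic is the Taylor polynomial of [expR] to second order, so its logarithm
    agrees with [t] up to a cubic term: the derivative of the difference is
    [- (t ^+ 2 / 2)] over the quadratic, which is at least one half. *)
Lemma norm_ln_quad_sub_le t : `|ln (1 + t + t ^+ 2 / 2) - t| <= `|t| ^+ 3.
Proof.
pose q (s : R) : R := 1 + s + s ^+ 2 / 2.
pose f s : R := ln (q s) - s.
pose df s : R := - (s ^+ 2 / 2) / q s.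
have q0 s : q s != 0 by rewrite gt_eqF// quad_gt0.
have dq (s : R) : is_derive s 1 q (1 + s).
  have h := is_deriveD (is_deriveD (is_derive_cst (1 : R) s 1) (is_derive_id s 1))
    (is_deriveZ (2^-1 : R) (is_deriveX 2 (is_derive_id s 1))).
  rewrite (_ : q = (cst 1 + id) + (2^-1 *: (id ^+ 2))); last first.
    by apply/funext => u; rewrite /q /GRing.scale /=; congr (_ + _); rewrite mulrC.
  by apply: (is_derive_eq h); rewrite /GRing.scale /=; field.
have fd (s : R) : is_derive s 1 f (df s).
  have dl := is_derive1_ln (quad_gt0 s).
  have h := is_deriveB (@is_derive1_comp R (@ln R) q s _ _ dl (dq s)) (is_derive_id s 1).
  apply: (is_derive_eq h).
  rewrite /df -/(q s) -[X in _ - X](divff (q0 s)) mulrC -mulrBl; congr (_ / _).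
  by rewrite /q; ring.
have cf : continuous f.
  by move=> s; apply: differentiable_continuous; apply/derivable1_diffP; case: (fd s).
have f0 : f 0 = 0 by rewrite /f /q expr0n /= mul0r !addr0 ln1 subr0.
have bound c : `|c| <= `|t| -> `|df c| <= t ^+ 2.
  have qc0 : 0 < q c by exact: quad_gt0.
  move=> ct; rewrite /df mulNr normrN ger0_norm; last first.
    by rewrite divr_ge0 ?(ltW qc0)// divr_ge0// sqr_ge0.
  rewrite ler_pdivrMr//.
  have c2 : c ^+ 2 <= t ^+ 2.
    by rewrite -(real_normK (num_real c)) -(real_normK (num_real t)) lerXn2r ?nnegrE.
  have := quad_ge c; rewrite -/(q c) => qc.
  have := sqr_ge0 t; nra.
rewrite -/(q t) -/(f t).
have [t0|t0] := leP 0 t.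
  have [c] := MVT_segment t0 (fun x _ => fd x) (continuous_subspaceT cf).
  rewrite in_itv/= f0 !subr0 => /andP[c0 ct] ->.
  rewrite normrM exprSr ler_wpM2r// real_normK ?num_real// bound//.
  by rewrite !ger0_norm// (le_trans c0).
have [c] := MVT_segment (ltW t0) (fun x _ => fd x) (continuous_subspaceT cf).
rewrite in_itv/= f0 !sub0r => /andP[tc c0] h.
rewrite -normrN h normrM normrN exprSr ler_wpM2r// real_normK ?num_real// bound//.
by rewrite !ler0_norm ?lerN2// ltW.
Qed.

(** From [1 - x / 2 <= expR (- (x / 2))], squared and inverted. *)
Lemma expR_le_quad x : x <= 1 -> expR x <= 1 + x + 2 * x ^+ 2.
Proof.
move=> x1.
have h2 : 1 - x / 2 <= expR (- (x / 2)) by rewrite (le_trans _ (expR_ge1Dx _)).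
have p0 : 0 < 1 - x / 2 by lra.
have -> : expR x = (expR (- (x / 2)) ^+ 2)^-1.
  by rewrite -expRM_natl -expRN; congr expR; field.
have e0 : 0 < expR (- (x / 2)) ^+ 2 by rewrite exprn_gt0// expR_gt0.
have q0 : 0 < 1 + x + 2 * x ^+ 2 by have := sqr_ge0 (x + 1 / 4); lra.
rewrite invf_ple ?posrE//.
apply: (@le_trans _ _ ((1 - x / 2) ^+ 2)); last first.
  by rewrite lerXn2r ?nnegrE// ltW// expR_gt0.
rewrite -[leLHS]mul1r ler_pdivrMr//.
rewrite -subr_ge0.
have -> : (1 - x / 2) ^+ 2 * (1 + x + 2 * x ^+ 2) - 1 =
  2^-1 * x ^+ 2 * ((1 - x) * (5 / 2 - x)) by field.
apply: mulr_ge0; first by rewrite mulr_ge0 ?sqr_ge0.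
by apply: mulr_ge0; lra.
Qed.

(** With [D = 1 + t + t ^+ 2 / 2], [U = ln D] and [x = lam - 1], the left side is
    [D * expR (x * U)].  For [`|t| <= 1] it expands to [D + x * (D * U)] up to
    [x ^+ 2 * U ^+ 2], and [D * U] equals [t + t ^+ 2] up to a cubic term, which makes
    the first order in [x] agree with that of the right side.  The remaining errors
    [delta ^+ 2 * t ^+ 2] and [delta * `|t| ^+ 3] are absorbed, the second one by the
    arithmetic-geometric inequality between [delta ^+ 2 * t ^+ 2] and [t ^+ 4].  For
    [`|t| > 1] the left side is of order [`|t| `^ (2 * lam)] and [lam <= b]. *)
Lemma expR_scaled_ln_quad_le (b lam delta t : R) :
  b <= 2 -> `|lam - 1| <= delta -> delta <= 2^-1 -> delta <= b - 1 ->
  expR (lam * ln (1 + t + t ^+ 2 / 2)) <=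
  1 + lam * t + (lam * t) ^+ 2 / 2 + 22 * (delta ^+ 2 * t ^+ 2 + `|t| `^ (2 * b)).
Proof.
move=> b2 ld d2 db.
pose D := 1 + t + t ^+ 2 / 2; pose U := ln D.
have D0 : 0 < D by exact: quad_gt0.
have [lam_ge lam_le] : 2^-1 <= lam /\ lam <= 1 + delta by move: ld; rewrite ler_norml; lra.
have P0 : 0 <= `|t| `^ (2 * b) by exact: powR_ge0.
have t20 := sqr_ge0 t.
have d0 : 0 <= delta by exact: le_trans ld.
have [t1|t1] := leP `|t| 1; last first.
  have D2 : D <= 5 / 2 * `|t| ^+ 2.
    have := ler_norm t; rewrite /D -(real_normK (num_real t)); nra.
  have a0 : 0 < `|t| by exact: lt_trans t1.
  have : expR (lam * ln D) <= 22 * `|t| `^ (2 * b).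
    have -> : expR (lam * ln D) = D `^ lam by rewrite /powR gt_eqF.
    apply: (@le_trans _ _ ((5 / 2 * `|t| ^+ 2) `^ lam)).
      by apply: ge0_ler_powR; rewrite ?nnegrE ?(ltW D0) ?mulr_ge0//; lra.
    rewrite powRM ?sqr_ge0//.
    apply: ler_pM; rewrite ?powR_ge0//.
      apply: (@le_trans _ _ ((5 / 2) `^ 2%:R)); first by apply: ler_powR; lra.
      by rewrite powR_mulrn; lra.
    rewrite -powR_mulrn// -powRrM; apply: ler_powR; [exact: ltW|lra].
  rewrite -/D -/U => h.
  have := sqr_ge0 (lam * t + 1); have := sqr_ge0 (delta * t); nra.
pose x := lam - 1; pose w := U - t; pose a := `|t|.
have wle : `|w| <= a ^+ 3 by exact: norm_ln_quad_sub_le.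
have t2a : t ^+ 2 = a ^+ 2 by rewrite /a real_normK// num_real.
have a0 : 0 <= a by exact: normr_ge0.
have a1 : a <= 1 by [].
have a3a : a ^+ 3 <= a ^+ 2 by rewrite exprS ler_piMl ?sqr_ge0.
have a2a : a ^+ 2 <= a by rewrite expr2 ler_piMl.
have a4 : a ^+ 4 <= `|t| `^ (2 * b).
  rewrite -powR_mulrn// -/a.
  have [->|an0] := eqVneq a 0; first by rewrite powR0 ?pnatr_eq0// powR_ge0.
  apply: ger_powR; last by lra.
  by rewrite lt0r an0 a0.
have Ule : `|U| <= 2 * a.
  have -> : U = w + t by rewrite /w subrK.
  rewrite (le_trans (ler_normD _ _))// -/a; lra.
have U2 : U ^+ 2 <= 4 * a ^+ 2.
  by rewrite -(real_normK (num_real U)); have := normr_ge0 U; nra.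
have D52 : D <= 5 / 2.
  by rewrite /D t2a; have := ler_norm t; rewrite -/a; nra.
have xd : `|x| <= delta by [].
have xU : x * U <= 1.
  rewrite (le_trans (ler_norm _))// normrM; have := normr_ge0 U; have := normr_ge0 x; nra.
have -> : lam * ln D = U + x * U by rewrite /x /U; ring.
rewrite expRD lnK ?posrE//.
have step1 : D * expR (x * U) <= D * (1 + x * U + 2 * (x * U) ^+ 2).
  by rewrite ler_wpM2l ?expR_le_quad// ltW.
have DU : `|D * U - (t + t ^+ 2)| <= 3 * a ^+ 3.
  have -> : D * U - (t + t ^+ 2) = t ^+ 3 / 2 + D * w by rewrite /w /D; field.
  rewrite (le_trans (ler_normD _ _))// (normrM (t ^+ 3)) (normrM D) normrX -/a
    (gtr0_norm D0) (@ger0_norm _ 2^-1)//.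
  have := normr_ge0 w; nra.
have xDU : x * (D * U - (t + t ^+ 2)) <= delta * (3 * a ^+ 3).
  by rewrite (le_trans (ler_norm _))// normrM ler_pM.
have x2 : x ^+ 2 <= delta ^+ 2.
  by rewrite -(real_normK (num_real x)) lerXn2r ?nnegrE.
have xU2 : D * (2 * (x * U) ^+ 2) <= 20 * (delta ^+ 2 * t ^+ 2).
  have : x ^+ 2 * U ^+ 2 <= delta ^+ 2 * (4 * a ^+ 2) by apply: ler_pM; rewrite ?sqr_ge0.
  rewrite t2a exprMn => xU4.
  apply: (@le_trans _ _ (5 / 2 * (2 * (x ^+ 2 * U ^+ 2)))); last lra.
  by apply: ler_wpM2r => //; rewrite mulr_ge0// mulr_ge0 ?sqr_ge0.
have da : delta * (3 * a ^+ 3) <= 3 / 2 * (delta ^+ 2 * t ^+ 2 + a ^+ 4).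
  have := sqr_ge0 (delta * a - a ^+ 2); rewrite t2a.
  have -> : (delta * a - a ^+ 2) ^+ 2 =
      delta ^+ 2 * a ^+ 2 + a ^+ 4 - 2 * (delta * a ^+ 3) by ring.
  lra.
apply: (le_trans step1).
have -> : D * (1 + x * U + 2 * (x * U) ^+ 2) =
   D + x * (t + t ^+ 2) + x * (D * U - (t + t ^+ 2)) + D * (2 * (x * U) ^+ 2) by ring.
have -> : 1 + lam * t + (lam * t) ^+ 2 / 2 = D + x * (t + t ^+ 2) + x ^+ 2 * t ^+ 2 / 2.
  by rewrite /D /x; field.
have : 0 <= x ^+ 2 * t ^+ 2 by rewrite mulr_ge0 ?sqr_ge0.
have : 0 <= delta ^+ 2 * t ^+ 2 by rewrite mulr_ge0 ?sqr_ge0.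
lra.
Qed.

End scaled_log.

(** * Majorants of the scores *)

Section majorants.
Context (R : realType).

Lemma powR_add_le (p q b : R) : 0 <= p -> 0 <= q -> 0 <= b ->
  (p + q) `^ b <= 2 `^ b * (p `^ b + q `^ b).
Proof.
move=> p0 q0 b0; wlog pq : p q p0 q0 / p <= q.
  move=> h; have [pq|/ltW qp] := leP p q; first exact: h.
  by rewrite addrC [leRHS]mulrC -[X in _ <= X]mulrC [X in _ * X]addrC; exact: h.
apply: (@le_trans _ _ ((2 * q) `^ b)).
  by apply: ge0_ler_powR; rewrite ?nnegrE ?addr_ge0 ?mulr_ge0//; lra.
by rewrite powRM// ler_wpM2l ?powR_ge0// lerDr powR_ge0.
Qed.

(** [expR_scaled_ln_quad_le] at [t = s / lam]; since [2^-1 <= lam], passing from [t]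
    to [s] multiplies the error by at most [16], and [352 = 22 * 16]. *)
Lemma catoni_scaled_le (psi : R -> R) (b lam delta s : R) :
  (forall x, psi x <= ln (1 + x + `|x| `^ 2 / 2)) ->
  1 < b -> b <= 2 -> `|lam - 1| <= delta -> delta <= 2^-1 -> delta <= b - 1 ->
  expR (lam * psi (s / lam)) <=
  1 + s + s ^+ 2 / 2 + 352 * (delta ^+ 2 * s ^+ 2 + `|s| `^ (2 * b)).
Proof.
move=> hpsi b1 b2 ld d2 db.
have lam_ge : 2^-1 <= lam by move: ld; rewrite ler_norml; lra.
have lam0 : 0 < lam by lra.
have ls : lam * (s / lam) = s by rewrite mulrC divfK// gt_eqF.
have -> : 1 + s + s ^+ 2 / 2 =
  1 + lam * (s / lam) + (lam * (s / lam)) ^+ 2 / 2 by rewrite ls.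
set t := s / lam in ls *.
have h : expR (lam * psi t) <= expR (lam * ln (1 + t + t ^+ 2 / 2)).
  rewrite ler_expR ler_pM2l//; have := hpsi t.
  by rewrite powR_mulrn// real_normK// num_real.
apply: (le_trans h); apply: (le_trans (expR_scaled_ln_quad_le _ b lam delta t b2 ld d2 db)).
rewrite lerD2l.
have nt : `|t| <= 2 * `|s|.
  have -> : `|s| = lam * `|t| by rewrite -(gtr0_norm lam0) -normrM ls.
  have := normr_ge0 t; nra.
have t2 : t ^+ 2 <= 4 * s ^+ 2.
  rewrite -(real_normK (num_real t)) -(real_normK (num_real s)).
  have := normr_ge0 t; nra.
have tb : `|t| `^ (2 * b) <= 16 * `|s| `^ (2 * b).
  apply: (@le_trans _ _ ((2 * `|s|) `^ (2 * b))).
    by apply: ge0_ler_powR; rewrite ?nnegrE ?mulr_ge0//; lra.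
  rewrite powRM// ler_wpM2r ?powR_ge0//.
  apply: (@le_trans _ _ (2 `^ 4%:R)); first by apply: ler_powR; lra.
  by rewrite powR_mulrn//; lra.
have : delta ^+ 2 * t ^+ 2 <= delta ^+ 2 * (4 * s ^+ 2) by rewrite ler_wpM2l ?sqr_ge0.
have : 0 <= delta ^+ 2 * s ^+ 2 by rewrite mulr_ge0 ?sqr_ge0.
have := powR_ge0 `|s| (2 * b).
lra.
Qed.

(** The power of [`|y - h|] is replaced by powers of [`|y|] and [sigma], at the price
    of a factor [16], and [5632 = 352 * 16]. *)
Lemma location_majorant (b A h sigma delta y : R) :
  1 < b -> b <= 2 -> 0 <= A -> 0 <= h -> h <= sigma ->
  1 + A * (y - h) + (A * (y - h)) ^+ 2 / 2 +
    352 * (delta ^+ 2 * (A * (y - h)) ^+ 2 + `|A * (y - h)| `^ (2 * b)) <=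
  (1 - A * h + (2^-1 + 352 * delta ^+ 2) * (A * h) ^+ 2 +
     5632 * A `^ (2 * b) * sigma `^ (2 * b)) +
  (A - 2 * (2^-1 + 352 * delta ^+ 2) * A ^+ 2 * h) * y +
  (2^-1 + 352 * delta ^+ 2) * A ^+ 2 * y ^+ 2 +
  5632 * A `^ (2 * b) * `|y| `^ (2 * b).
Proof.
move=> b1 b2 A0 h0 hs.
have sb : `|A * (y - h)| `^ (2 * b) <=
    16 * A `^ (2 * b) * (`|y| `^ (2 * b) + sigma `^ (2 * b)).
  rewrite normrM (ger0_norm A0) powRM// -mulrA mulrCA ler_wpM2l ?powR_ge0//.
  have s0 : 0 <= sigma by exact: le_trans hs.
  apply: (@le_trans _ _ ((`|y| + sigma) `^ (2 * b))).
    apply: ge0_ler_powR; rewrite ?nnegrE ?addr_ge0//; first by lra.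
    by rewrite (le_trans (ler_normB _ _))// lerD2l (ger0_norm h0).
  have b0 : 0 <= 2 * b by lra.
  apply: (le_trans (powR_add_le _ _ _ (normr_ge0 y) s0 b0)).
  rewrite ler_wpM2r ?addr_ge0 ?powR_ge0//.
  apply: (@le_trans _ _ (2 `^ 4%:R)); first by apply: ler_powR; lra.
  by rewrite powR_mulrn//; lra.
move: sb; move: (`|A * (y - h)| `^ _) => z zle.
rewrite -subr_ge0.
rewrite [X in 0 <= X](_ : _ = 352 * (16 * A `^ (2 * b) *
  (`|y| `^ (2 * b) + sigma `^ (2 * b)) - z)); last by field.
by rewrite mulr_ge0// subr_ge0.
Qed.

(** Young's inequality [2 * y * h <= kappa * y ^+ 2 + h ^+ 2 / kappa], with both
    signs, the weight [kappa] being adapted to the bound on [h]. *)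
Lemma sqr_shift_bounds (kappa sigma y h : R) :
  0 < kappa -> kappa <= 1 -> 0 < sigma -> `|h| <= kappa * sigma ->
  (1 - kappa) * (y ^+ 2 - kappa * sigma ^+ 2) <= (y - h) ^+ 2 <=
  (1 + kappa) * (y ^+ 2 + kappa * sigma ^+ 2).
Proof.
move=> k0 k1 s0 hk.
have h2 : h ^+ 2 <= kappa ^+ 2 * sigma ^+ 2.
  rewrite -exprMn -(real_normK (num_real h)) lerXn2r// nnegrE//.
  by rewrite mulr_ge0// ltW.
have key : 0 <= (kappa * y - h) ^+ 2 by exact: sqr_ge0.
have key2 : 0 <= (kappa * y + h) ^+ 2 by exact: sqr_ge0.
apply/andP; split; rewrite -(ler_pM2l k0).
  have : (1 - kappa) * h ^+ 2 <= (1 - kappa) * (kappa ^+ 2 * sigma ^+ 2).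
    by rewrite ler_wpM2l// subr_ge0.
  nra.
have : (1 + kappa) * h ^+ 2 <= (1 + kappa) * (kappa ^+ 2 * sigma ^+ 2).
  by rewrite ler_wpM2l// addr_ge0// ltW.
nra.
Qed.

Lemma scale_powR_le (b sigma y Z : R) :
  1 < b -> b <= 2 -> 0 < sigma -> `|Z| <= 2 * (y ^+ 2 / sigma ^+ 2) + 3 ->
  `|Z| `^ b / b <= 16 / sigma `^ (2 * b) * `|y| `^ (2 * b) + 36.
Proof.
move=> b1 b2 s0 hZ.
have b0 : 0 <= b by lra.
have pow4 (u : R) : 1 <= u -> u `^ b <= u ^+ 2.
  by move=> u1; rewrite -powR_mulrn; [exact: ler_powR|lra].
have q0 : 0 <= y ^+ 2 / sigma ^+ 2 by rewrite divr_ge0// sqr_ge0.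
have qb : (y ^+ 2 / sigma ^+ 2) `^ b = `|y| `^ (2 * b) / sigma `^ (2 * b).
  have sqb (u : R) : (u ^+ 2) `^ b = `|u| `^ (2 * b).
    by rewrite -(real_normK (num_real u)) powRrM powR_mulrn.
  rewrite powRM ?sqr_ge0// ?invr_ge0 ?sqr_ge0// sqb; congr (_ * _).
  by rewrite -[_^-1 in LHS]powR_inv1 ?sqr_ge0// powRAC sqb gtr0_norm//
     powR_inv1// powR_ge0.
have Zb : `|Z| `^ b <= 4 * (4 * (`|y| `^ (2 * b) / sigma `^ (2 * b)) + 9).
  apply: (@le_trans _ _ ((2 * (y ^+ 2 / sigma ^+ 2) + 3) `^ b)).
    by apply: ge0_ler_powR; rewrite ?nnegrE// addr_ge0// mulr_ge0.
  have t0 : 0 <= 2 * (y ^+ 2 / sigma ^+ 2) by rewrite mulr_ge0.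
  apply: (le_trans (powR_add_le _ 3 _ t0 (ler0n _ _) b0)).
  apply: ler_pM; rewrite ?addr_ge0 ?powR_ge0//.
    by rewrite (le_trans (pow4 2 _))//; lra.
  apply: lerD; last by rewrite (le_trans (pow4 3 _))//; lra.
  rewrite powRM// qb ler_wpM2r ?divr_ge0 ?powR_ge0//.
  by rewrite (le_trans (pow4 2 _))//; lra.
rewrite ler_pdivrMr; last by lra.
apply: (le_trans Zb).
have : 0 <= `|y| `^ (2 * b) / sigma `^ (2 * b) by rewrite divr_ge0 ?powR_ge0.
rewrite mulrAC -(mulrA 16); move: (_ / _) => u; nra.
Qed.

End majorants.

(** * Arithmetic of the rates *)

Section rates.
Context (R : realType).
Implicit Types (b r B : R).

(** [w] is the common currency: the condition on [r] makes it at most [B^-1],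
    and [rho <= w] because [b - 1 <= 1].  The power [(2 * r) `^ b] is the order of the
    heavy-tail part of the location error; it is smaller than
    [r * rho] by the factor [w] since [r `^ (b - 1) = rho `^ b]. *)
Lemma rate_facts b r B : 1 < b -> b <= 2 -> 1 <= B -> 0 < r ->
  r * B `^ (b / (b - 1) ^+ 2) <= 1 ->
  let al := r `^ b^-1 in let rho := r `^ ((b - 1) / b) in let w := rho `^ (b - 1) in
  [/\ 0 < rho, 0 < al, al <= rho, al * rho = r & al `^ b = r] /\
  [/\ rho <= w, w <= B^-1 & (2 * r) `^ b <= 4 * (r * (rho * w))].
Proof.
move=> b1 b2 B1 r0 rB al rho w.
have bp : 0 < b by lra.
have b10 : 0 < b - 1 by lra.
have bn : b != 0 by rewrite gt_eqF.
have b1n : b - 1 != 0 by rewrite gt_eqF.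
have B0 : 0 < B by lra.
pose e := b / (b - 1) ^+ 2.
have e0 : 0 < e by rewrite divr_gt0// exprn_gt0.
have Be0 : 0 < B `^ e by exact: powR_gt0.
have rle : r <= (B `^ e)^-1 by rewrite -[leRHS]mul1r ler_pdivlMr.
have Be1 : 1 <= B `^ e by rewrite -[leLHS](powRr0 B); apply: ler_powR => //; exact: ltW.
have r1 : r <= 1 by rewrite (le_trans rle)// invf_le1.
have r01 : 0 < r <= 1 by rewrite r0.
have rho0 : 0 < rho by exact: powR_gt0.
have rho1 : rho <= 1.
  by rewrite /rho -[leRHS](powRr0 r); apply: (ger_powR r01); rewrite divr_ge0 ?ltW.
have wE : w = r `^ e^-1.
  by rewrite /w /rho -powRrM; congr (_ `^ _); rewrite /e invf_div expr2 mulrAC.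
split; split => //.
- exact: powR_gt0.
- apply: (ger_powR r01); rewrite -[leRHS]mul1r ler_pM2r ?invr_gt0//; lra.
- rewrite /al /rho -powRD; last by apply/implyP => _; rewrite gt_eqF.
  rewrite (_ : b^-1 + (b - 1) / b = 1) ?powRr1 ?(ltW r0)//.
  by apply: (mulIf bn); rewrite mulrDl divfK// mulVf//; ring.
- by rewrite /al -powRrM mulVf// powRr1// ltW.
- by apply: ger1_powR; [rewrite rho0|lra].
- rewrite wE; apply: (@le_trans _ _ ((B `^ e)^-1 `^ e^-1)).
    by apply: ge0_ler_powR; rewrite ?nnegrE ?invr_ge0 ?(ltW e0) ?(ltW r0) ?(ltW Be0).
  rewrite -powRN -powRrM mulNr divff ?gt_eqF// powR_inv1//; exact: ltW.
- have -> : r * (rho * w) = r `^ b.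
    have -> : rho * w = r `^ (b - 1).
      rewrite wE /rho -powRD; last by apply/implyP => _; rewrite gt_eqF.
      congr (_ `^ _); rewrite /e invf_div -mulrDl; apply: (mulIf bn).
      by rewrite divfK//; ring.
    by rewrite mulr_powRB1// ltW.
  rewrite powRM//; last exact: ltW.
  rewrite ler_wpM2r ?powR_ge0//.
  apply: (@le_trans _ _ (2 `^ 2%:R)); first by apply: ler_powR; lra.
  by rewrite powR_mulrn//; lra.
Qed.

(** With [ak = 2 * r * (1 + rho)] the terms of order [r] cancel:
    [- ak + 2^-1 * (2 * r) + r = - 2 * r * rho].  All other terms are [r * rho]
    multiplied by quantities controlled by [w * c ^+ 2 <= 100 ^- 3]. *)
Lemma location_budget (r rho w c ms aq ak : R) :
  0 < r -> 0 < rho -> rho <= w -> w <= (100 ^+ 3 * c ^+ 2)^-1 -> r <= rho ^+ 2 ->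
  0 <= ms -> c = 49 + 16 * ms -> 0 <= aq -> aq <= 4 * (r * (rho * w)) ->
  ak = 2 * r * (1 + rho) ->
  1 - ak + (2^-1 + 352 * (c * rho) ^+ 2) * ak ^+ 2 + 5632 * aq +
  (2^-1 + 352 * (c * rho) ^+ 2) * (2 * r) + 5632 * (aq * ms) - 1 + r <= 0.
Proof.
move=> r0 rho0 rw wc rr ms0 cE aq0 aqle akE.
have c1 : 1 <= c by lra.
have msc : 1 + ms <= c by lra.
have w0 : 0 < w by exact: lt_le_trans rw.
have c20 : 0 < c ^+ 2 by rewrite exprn_gt0//; lra.
pose k : R := (100 ^+ 3)^-1.
have wc2 : w * c ^+ 2 <= k.
  by rewrite -ler_pdivlMr// (le_trans wc)// invfM.
have wc1 : w * c <= k.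
  rewrite (le_trans _ wc2)// ler_wpM2l ?(ltW w0)// expr2 ler_peMr//; lra.
have wk : w <= k by rewrite (le_trans _ wc1)// ler_peMr// ltW.
have k0 : 0 < k by rewrite invr_gt0 exprn_gt0.
have k1 : k <= 1 by rewrite invf_le1 ?exprn_gt0// exprn_ege1// ler1n.
have rhok : rho <= k by exact: le_trans wk.
have rho1 : rho <= 1 by exact: le_trans k1.
have d2 : (c * rho) ^+ 2 <= rho * k.
  rewrite exprMn mulrC expr2 -mulrA ler_wpM2l ?(ltW rho0)//.
  by rewrite (le_trans _ wc2)// ler_wpM2r// ltW.
have d1 : (c * rho) ^+ 2 <= 1.
  by rewrite (le_trans d2)// mulr_ile1// ltW.
have d0 : 0 <= (c * rho) ^+ 2 by exact: sqr_ge0.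
have t1 : aq * (1 + ms) <= 4 * (r * (rho * w)) * c.
  by apply: ler_pM => //; rewrite addr_ge0.
have t2 : 4 * (r * (rho * w)) * c <= 4 * (r * rho * k).
  have -> : 4 * (r * (rho * w)) * c = 4 * (r * rho * (w * c)) by ring.
  by rewrite ler_pM2l// ler_wpM2l// mulr_ge0// ltW.
have s4 : (1 + rho) ^+ 2 <= 2 ^+ 2.
  rewrite lerXn2r ?nnegrE ?addr_ge0 ?(ltW rho0)//.
  by rewrite -[leRHS]/(1 + 1) lerD2l.
have t3 : ak ^+ 2 <= 16 * (r * rho * k).
  have -> : ak ^+ 2 = 4 * (1 + rho) ^+ 2 * (r * r) by rewrite akE; ring.
  have rrk : r * r <= r * rho * k.
    by rewrite -mulrA ler_wpM2l ?(ltW r0)// (le_trans rr)// expr2 ler_wpM2l// ltW.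
  have rrk0 : 0 <= r * rho * k by rewrite !mulr_ge0 ?ltW.
  apply: (@le_trans _ _ (4 * (1 + rho) ^+ 2 * (r * rho * k))).
    by rewrite ler_wpM2l// mulr_ge0// sqr_ge0.
  by rewrite ler_wpM2r//; move: s4; clear; lra.
have t30 : 0 <= ak ^+ 2 by exact: sqr_ge0.
have t4 : (c * rho) ^+ 2 * ak ^+ 2 <= ak ^+ 2 by rewrite ler_piMl.
have t5 : (c * rho) ^+ 2 * r <= r * rho * k.
  by rewrite mulrC -mulrA ler_wpM2l// ltW.
have t6 : 0 < r * rho by rewrite mulr_gt0.
have t7 : r * rho = 1000 * (1000 * (r * rho * k)).
  have -> : 1000 * (1000 * (r * rho * k)) = r * rho * (100 ^+ 3 * k) by ring.
  by rewrite divff ?mulr1// expf_neq0.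
move: t1 t2 t3 t30 t4 t5 t6 t7; rewrite [in _ - ak]akE.
move: (ak ^+ 2) ((c * rho) ^+ 2) (_ * c) (r * rho * k) => u D z v; clear; lra.
Qed.

(** The drift [- c * rho] created by enlarging the scale pays for the deviation term
    [36 + 16 * ms + 1] and for the displacement [kappa <= 3 * rho] of the location,
    which costs at most [9 * rho]; [c = 49 + 16 * ms] leaves room for both. *)
Lemma scale_budget_upper (al rho c ms kappa : R) :
  0 < al -> 0 < rho -> 0 <= kappa -> kappa <= 3 * rho -> kappa <= 1 -> 
  0 <= ms -> c = 49 + 16 * ms -> c * rho <= 1 ->
  al * ((1 + kappa) ^+ 2 * (1 - c * rho) - 1) + 36 * (al * rho) +
    16 * (al * rho) * ms + al * rho <= 0.
Proof.
move=> al0 rho0 k0 k3 k1 ms0 cE cr1.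
have -> : al * ((1 + kappa) ^+ 2 * (1 - c * rho) - 1) + 36 * (al * rho) +
    16 * (al * rho) * ms + al * rho =
    al * ((1 + kappa) ^+ 2 * (1 - c * rho) - 1 + (c - 12) * rho) by rewrite cE; ring.
rewrite pmulr_rle0//.
have cr0 : 0 <= c * rho by rewrite mulr_ge0 ?(ltW rho0)//; lra.
have h : (1 + kappa) ^+ 2 * (1 - c * rho) <= (1 + 3 * kappa) * (1 - c * rho).
  by rewrite ler_wpM2r; nra.
nra.
Qed.

Lemma scale_budget_lower (al rho c ms kappa : R) :
  0 < al -> 0 < rho -> 0 <= kappa -> kappa <= 3 * rho -> kappa <= 1 ->
  0 <= ms -> c = 49 + 16 * ms -> c * rho <= 1 ->
  - (al * ((1 - kappa) ^+ 2 * (1 + c * rho) - 1)) + 36 * (al * rho) +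
    16 * (al * rho) * ms + al * rho <= 0.
Proof.
move=> al0 rho0 k0 k3 k1 ms0 cE cr1.
have -> : - (al * ((1 - kappa) ^+ 2 * (1 + c * rho) - 1)) + 36 * (al * rho) +
    16 * (al * rho) * ms + al * rho =
    al * (1 - (1 - kappa) ^+ 2 * (1 + c * rho) + (c - 12) * rho) by rewrite cE; ring.
rewrite pmulr_rle0//.
have cr0 : 0 <= c * rho by rewrite mulr_ge0 ?(ltW rho0)//; lra.
have h : (1 - 2 * kappa) * (1 + c * rho) <= (1 - kappa) ^+ 2 * (1 + c * rho).
  by rewrite ler_wpM2r; nra.
nra.
Qed.

End rates.

Section budget_rewriting.
Context (R : realType).
Implicit Types n r L X A S al m ms : R.

Lemma sample_budget n r L X : 0 <= n -> n * r = L -> X + r <= 0 -> n * X + L <= 0.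
Proof. by move=> n0 <- Xr; rewrite -mulrDr mulr_ge0_le0. Qed.

Lemma location_budgetE A h sigma Aq S m ms K k r ak aq :
  A * h = ak -> A ^+ 2 * sigma ^+ 2 = 2 * r -> Aq * S = aq -> m = ms * S ->
  1 - A * h + K * (A * h) ^+ 2 + k * Aq * S + K * A ^+ 2 * sigma ^+ 2 +
    k * Aq * m - 1 + r =
  1 - ak + K * ak ^+ 2 + k * aq + K * (2 * r) + k * (aq * ms) - 1 + r.
Proof. by move=> <- <- <- ->; ring. Qed.

Lemma scale_budgetE al p q u s2 S m ms r k l :
  p * s2 = u -> m = ms * S -> S != 0 ->
  1 + al * q + k * r + al * p * s2 + r * (l / S) * m - 1 + r =
  al * (u + q) + k * r + l * r * ms + r.
Proof. by move=> <- -> S0; field. Qed.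

Lemma norm_affine_le_upper (u k s2 y2 : R) :
  0 <= u <= 2 -> 0 <= k <= 1 -> 0 <= y2 / s2 ->
  `|u / s2 * y2 + (u * k - 1)| <= 2 * (y2 / s2) + 3.
Proof.
move=> u02 k01; rewrite mulrAC -mulrA; move: (y2 / s2) => Y Y0.
by rewrite ler_norml; nra.
Qed.

Lemma norm_affine_le_lower (u k s2 y2 : R) :
  0 <= u <= 2 -> 0 <= k <= 1 -> 0 <= y2 / s2 ->
  `|- u / s2 * y2 + (u * k + 1)| <= 2 * (y2 / s2) + 3.
Proof.
move=> u02 k01; rewrite mulrAC -mulrA; move: (y2 / s2) => Y Y0.
by rewrite ler_norml; nra.
Qed.

End budget_rewriting.


(** * Sums of scores with high probability *)

Lemma near1_gt0 (R : realType) (lam delta : R) :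
  `|lam - 1| <= delta -> delta <= 2^-1 -> 0 < lam.
Proof. by rewrite ler_norml; lra. Qed.

(** Young's inequality for the product of [`|x|] and 1. *)
Lemma power_quad_gt0 (R : realType) (b x : R) :
  1 < b -> 0 < 1 + x + `|x| `^ b / b.
Proof.
move=> b1; have b0 : 0 < b by lra.
have q0 : 0 < b / (b - 1) by rewrite divr_gt0//; lra.
have bV : 0 < b^-1 by rewrite invr_gt0.
have conj : b^-1 + (b / (b - 1))^-1 = 1.
  by rewrite invf_div mulrBl divff ?gt_eqF// mul1r addrC subrK.
have := conjugate_powR (normr_ge0 x) ler01 b0 q0 conj.
rewrite powR1 mulr1 mul1r.
have := ler_norm (- x); rewrite normrN; move: conj; lra.
Qed.

Section score_events.
Context (R : realType) d (T : measurableType d) (P : probability T R).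
Context (n : nat) (X : 'I_n -> {RV P >-> R}) (mu sigma m b eps : R).
Hypotheses (indX : mutually_independent X) (s0 : 0 < sigma) (b1 : 1 < b) (b2 : b <= 2)
  (eps0 : 0 < eps).
Hypothesis EX : (forall i, 'E_P[X i] = mu%:E)%E.
Hypothesis E2 :
  (forall i, 'E_P[fun w : T => (`|X i w - mu| ^+ 2)%R] = (sigma ^+ 2)%:E)%E.
Hypothesis Eb :
  (forall i, 'E_P[fun w : T => (`|X i w - mu| `^ (2 * b))%R] = m%:E)%E.

(** One event for all [lam] close to 1.  The sign [e] treats the two sides of the
    rectangle together: [e = 1] with [psi1] bounds [f1] from above on the right side,
    [e = -1] with [x |-> - psi1 (- x)] bounds it from below on the left side. *)
Lemma location_event (psi : R -> R) (e A h delta : R) :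
  (forall x, psi x <= ln (1 + x + `|x| `^ 2 / 2)) ->
  e ^+ 2 = 1 -> 0 <= A -> 0 <= h -> h <= sigma ->
  0 <= delta -> delta <= 2^-1 -> delta <= b - 1 ->
  n%:R * (1 - A * h + (2^-1 + 352 * delta ^+ 2) * (A * h) ^+ 2 +
     5632 * A `^ (2 * b) * sigma `^ (2 * b) +
    (2^-1 + 352 * delta ^+ 2) * A ^+ 2 * sigma ^+ 2 +
    5632 * A `^ (2 * b) * m - 1) + ln eps^-1 <= 0 ->
  exists E : set T, [/\ measurable E, ((1 - eps)%:E <= P E)%E &
    forall w, E w -> forall lam, `|lam - 1| <= delta ->
      \sum_(i < n) psi (A * (e * (X i w - mu) - h) / lam) <= 0].
Proof.
move=> hpsi e2 A0 h0 hs d0 d2 db budget.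
have e1 : `|e| = 1.
  have : `|e| ^+ 2 == 1 by rewrite (real_normK (num_real e)) e2.
  by rewrite sqrp_eq1// => /eqP.
pose c0 := 1 - A * h + (2^-1 + 352 * delta ^+ 2) * (A * h) ^+ 2 +
     5632 * A `^ (2 * b) * sigma `^ (2 * b).
pose c1 := e * (A - 2 * (2^-1 + 352 * delta ^+ 2) * A ^+ 2 * h).
pose c2 := (2^-1 + 352 * delta ^+ 2) * A ^+ 2.
pose c3 := 5632 * A `^ (2 * b).
have maj y lam : `|lam - 1| <= delta ->
    expR (lam * psi (A * (e * y - h) / lam)) <=
    c0 + c1 * y + c2 * y ^+ 2 + c3 * `|y| `^ (2 * b).
  move=> ld; apply: (le_trans (catoni_scaled_le _ psi b lam delta _ hpsi b1 b2 ld d2 db)).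
  apply: (le_trans (location_majorant _ b A h sigma delta (e * y) b1 b2 A0 h0 hs)).
  have ny : `|e * y| = `|y| by rewrite normrM e1 mul1r.
  rewrite [(e * y) ^+ 2]exprMn e2 mul1r ny.
  by rewrite (_ : _ * (e * y) = c1 * y)//; rewrite /c1; ring.
have g0 y : 0 <= c0 + c1 * y + c2 * y ^+ 2 + c3 * `|y| `^ (2 * b).
  by apply: le_trans (expR_ge0 _) (maj y 1 _); rewrite subrr normr0.
have [E [mE PE hE]] := chernoff_moment_poly _ _ _ P n X mu (sigma ^+ 2)
  (2 * b) m c0 c1 c2 c3 eps indX EX E2 Eb g0 eps0 budget.
exists E; split => // w Ew lam ld.
have lam0 : 0 < lam by exact: near1_gt0 ld d2.
have := hE w Ew (fun i => lam * psi (A * (e * (X i w - mu) - h) / lam))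
  (fun i => maj (X i w - mu) lam ld).
by rewrite -mulr_sumr pmulr_rle0.
Qed.

(** Stated for an arbitrary affine function [p * y ^+ 2 + q] of the square, to cover
    both the upper bound and the opposite of the lower bound on
    [(x - theta) ^+ 2 / v ^+ 2 - 1]. *)
Lemma scale_event (psi : R -> R) (al r p q : R) :
  (forall x, psi x <= ln (1 + x + `|x| `^ b / b)) ->
  0 < al -> al `^ b = r ->
  (forall y : R, `|p * y ^+ 2 + q| <= 2 * (y ^+ 2 / sigma ^+ 2) + 3) ->
  n%:R * (1 + al * q + 36 * r + al * p * sigma ^+ 2 +
    r * (16 / sigma `^ (2 * b)) * m - 1) + ln eps^-1 <= 0 ->
  exists E : set T, [/\ measurable E, ((1 - eps)%:E <= P E)%E &
    forall w, E w ->
      \sum_(i < n) psi (al * (p * (X i w - mu) ^+ 2 + q)) <= 0].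
Proof.
move=> hpsi al0 alr hZ budget.
have b0 : 0 < b by rewrite (lt_trans _ b1).
have r0 : 0 < r by rewrite -alr powR_gt0.
have maj y :
    expR (psi (al * (p * y ^+ 2 + q))) <=
    1 + al * q + 36 * r + 0 * y + al * p * y ^+ 2 +
    r * (16 / sigma `^ (2 * b)) * `|y| `^ (2 * b).
  have := scale_powR_le _ b sigma y _ b1 b2 s0 (hZ y).
  set Z := p * y ^+ 2 + q => Zle.
  have aZ : `|al * Z| `^ b = r * `|Z| `^ b.
    by rewrite normrM (gtr0_norm al0) powRM ?(ltW al0)// alr.
  have qb : 1 + al * Z + `|al * Z| `^ b / b <=
      1 + al * q + 36 * r + 0 * y + al * p * y ^+ 2 +
      r * (16 / sigma `^ (2 * b)) * `|y| `^ (2 * b).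
    rewrite aZ -mulrA.
    have : r * (`|Z| `^ b / b) <= r * (16 / sigma `^ (2 * b) * `|y| `^ (2 * b) + 36).
      by rewrite ler_pM2l.
    rewrite /Z => Hr; rewrite -subr_ge0 (_ : _ - _ =
        r * (16 / sigma `^ (2 * b) * `|y| `^ (2 * b) + 36) -
        r * (`|p * y ^+ 2 + q| `^ b / b)).
      by rewrite subr_ge0.
    by ring.
  apply: le_trans qb.
  have pos : 0 < 1 + al * Z + `|al * Z| `^ b / b by exact: power_quad_gt0.
  by rewrite -[leRHS]lnK ?posrE// ler_expR.
have [E [mE PE hE]] := chernoff_moment_poly _ _ _ P n X mu (sigma ^+ 2)
  (2 * b) m _ _ _ _ eps indX EX E2 Eb (fun y => le_trans (expR_ge0 _) (maj y)) eps0 budget.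
exists E; split => // w Ew.
exact: hE w Ew (fun i => psi (al * (p * (X i w - mu) ^+ 2 + q)))
  (fun i => maj (X i w - mu)).
Qed.

End score_events.

(** * From the sums of scores to the estimators *)

Section good_sample.
Context (R : realType).

(** The interval allowed for [v / sigma] lies within [delta] of 1, as required to use
    [location_event]. *)
Lemma scale_band (delta : R) : 0 <= delta -> delta <= 2^-1 ->
  let lo := (1 + delta) `^ (- (1 / 2)) in let hi := (1 - delta) `^ (- (1 / 2)) in
  [/\ 0 < lo, 1 - delta <= lo, lo <= hi & hi <= 1 + delta] /\
  (lo ^+ 2 = (1 + delta)^-1 /\ hi ^+ 2 = (1 - delta)^-1).
Proof.
move=> d0 d2 lo hi.
have sq (u : R) : 0 < u -> (u `^ (- (1 / 2))) ^+ 2 = u^-1.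
  move=> u0; rewrite -powR_mulrn ?powR_ge0// -powRrM -[RHS]powR_inv1 ?(ltW u0)//.
  by congr (_ `^ _); field.
have lo2 : lo ^+ 2 = (1 + delta)^-1 by apply: sq; lra.
have hi2 : hi ^+ 2 = (1 - delta)^-1 by apply: sq; lra.
have lo0 : 0 < lo by apply: powR_gt0; lra.
have hi0 : 0 < hi by apply: powR_gt0; lra.
split => //; split => //.
- rewrite -ler_sqr ?nnegrE ?(ltW lo0)//; last by lra.
  rewrite lo2 -[leRHS]mul1r ler_pdivlMr; last by lra.
  nra.
- by rewrite -ler_sqr ?nnegrE ?(ltW lo0) ?(ltW hi0)// lo2 hi2 lef_pV2 ?posrE; lra.
- rewrite -ler_sqr ?nnegrE ?(ltW hi0)//; last by lra.
  rewrite hi2 -[leLHS]mul1r ler_pdivrMr; last by lra.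
  nra.
Qed.

(** The deterministic part: the four sums determine the signs on the four sides of the
    rectangle.  On the sides where [theta] is fixed, [lam] stands for [v / sigma]. *)
Lemma solution_of_score_bounds (psi1 psi2 : R -> R) (beta eps : R) (n : nat)
    (x : 'I_n -> R) (mu sigma kappa delta : R) :
  let A := alpha1 n eps / sigma in let al := alpha2 beta n eps in
  continuous psi1 -> continuous psi2 ->
  {homo psi1 : x y / x <= y} -> {homo psi2 : x y / x <= y} ->
  0 < sigma -> 0 < kappa -> kappa <= 1 -> 0 <= delta -> delta <= 2^-1 ->
  (forall lam, `|lam - 1| <= delta ->
    \sum_(i < n) psi1 (A * (x i - mu - kappa * sigma) / lam) <= 0) ->
  (forall lam, `|lam - 1| <= delta ->
    0 <= \sum_(i < n) psi1 (A * (x i - mu + kappa * sigma) / lam)) ->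
  \sum_(i < n) psi2 (al * ((1 + kappa) * (1 - delta) / sigma ^+ 2 * (x i - mu) ^+ 2 +
    ((1 + kappa) * kappa * (1 - delta) - 1))) <= 0 ->
  0 <= \sum_(i < n) psi2 (al * ((1 - kappa) * (1 + delta) / sigma ^+ 2 * (x i - mu) ^+ 2 -
    ((1 - kappa) * kappa * (1 + delta) + 1))) ->
  exists t v, [/\ `|t - mu| <= kappa * sigma,
    (1 + delta) `^ (- (1 / 2)) * sigma <= v <= (1 - delta) `^ (- (1 / 2)) * sigma,
    f1 psi1 eps x t v = 0 & f2 psi2 beta eps x t v = 0].
Proof.
move=> A al c1 c2 mono1 mono2 s0 k0 k1 d0 d2 up1 low1 up2 low2.
have [[lo0 lo_ge lohi hi_le] [lo2 hi2]] := scale_band delta d0 d2.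
set lo := (1 + delta) `^ _ in lo0 lo_ge lohi lo2 *.
set hi := (1 - delta) `^ _ in lohi hi_le hi2 *.
have sn0 : sigma != 0 by rewrite gt_eqF.
have ks0 : 0 < kappa * sigma by rewrite mulr_gt0.
have lam_near v : lo * sigma <= v <= hi * sigma ->
    0 < v /\ `|v / sigma - 1| <= delta.
  move=> /andP[v_lo v_hi]; split; first by rewrite (lt_le_trans _ v_lo)// mulr_gt0.
  have : lo <= v / sigma by rewrite ler_pdivlMr.
  have : v / sigma <= hi by rewrite ler_pdivrMr.
  by move: lo_ge hi_le; rewrite ler_norml; lra.
have argE v t i : 0 < v ->
    alpha1 n eps * ((x i - t) / v) = A * (x i - t) / (v / sigma).
  by move=> v0; rewrite /A; field; rewrite sn0 gt_eqF.
have ninv : 0 <= n%:R^-1 :> R by rewrite invr_ge0 ler0n.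
have al0 : 0 <= al by exact: powR_ge0.
have s20 : 0 < sigma ^+ 2 by rewrite exprn_gt0.
have sqr_bounds t i : mu - kappa * sigma <= t <= mu + kappa * sigma ->
   (1 - kappa) * ((x i - mu) ^+ 2 - kappa * sigma ^+ 2) <= (x i - t) ^+ 2 <=
   (1 + kappa) * ((x i - mu) ^+ 2 + kappa * sigma ^+ 2).
  move=> tI; have -> : x i - t = (x i - mu) - (t - mu) by ring.
  by apply: sqr_shift_bounds => //; move: tI; rewrite ler_norml; lra.
have [t [v [tI vI F0 G0]]] : exists t v,
    [/\ mu - kappa * sigma <= t <= mu + kappa * sigma,
    lo * sigma <= v <= hi * sigma,
    f1 psi1 eps x t v = 0 & f2 psi2 beta eps x t v = 0].
  apply: exists_system_root => //.
  - by move: ks0; lra.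
  - by rewrite mulr_gt0.
  - by rewrite ler_pM2r.
  - move=> v /lam_near[v0 vl]; rewrite /f1 mulr_ge0//.
    rewrite (eq_bigr _ (fun i _ => congr1 psi1 (argE v _ i v0))).
    have argL i : x i - (mu - kappa * sigma) = x i - mu + kappa * sigma by ring.
    under eq_bigr do rewrite argL.
    exact: low1.
  - move=> v /lam_near[v0 vl]; rewrite /f1 mulr_ge0_le0//.
    rewrite (eq_bigr _ (fun i _ => congr1 psi1 (argE v _ i v0))).
    under eq_bigr do rewrite opprD addrA.
    exact: up1.
  - move=> t tI; rewrite /f2 mulr_ge0//; apply: (le_trans low2).
    apply: ler_sum => i _; apply: mono2; rewrite ler_wpM2l//.
    have /andP[lb _] := sqr_bounds t i tI.
    rewrite exprMn lo2 (invfM (1 + delta)^-1) invrK.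
    have -> : (1 - kappa) * (1 + delta) / sigma ^+ 2 * (x i - mu) ^+ 2 -
        ((1 - kappa) * kappa * (1 + delta) + 1) =
      (1 - kappa) * ((x i - mu) ^+ 2 - kappa * sigma ^+ 2) * ((1 + delta) / sigma ^+ 2) - 1.
      by field.
    rewrite lerD2r ler_wpM2r// divr_ge0 ?(ltW s20)//; lra.
  - move=> t tI; rewrite /f2 mulr_ge0_le0//; apply: (le_trans _ up2).
    apply: ler_sum => i _; apply: mono2; rewrite ler_wpM2l//.
    have /andP[_ ub] := sqr_bounds t i tI.
    rewrite exprMn hi2 (invfM (1 - delta)^-1) invrK.
    have -> : (1 + kappa) * (1 - delta) / sigma ^+ 2 * (x i - mu) ^+ 2 +
        ((1 + kappa) * kappa * (1 - delta) - 1) =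
      (1 + kappa) * ((x i - mu) ^+ 2 + kappa * sigma ^+ 2) * ((1 - delta) / sigma ^+ 2) - 1.
      by field.
    rewrite lerD2r ler_wpM2r// divr_ge0 ?(ltW s20)//; lra.
exists t, v; split => //.
by move: tI; rewrite ler_norml; lra.
Qed.

Lemma prob_setI_ge d (T : measurableType d) (P : probability T R) (A B : set T)
    (p q : R) :
  measurable A -> measurable B ->
  ((1 - p)%:E <= P A)%E -> ((1 - q)%:E <= P B)%E ->
  ((1 - (p + q))%:E <= P (A `&` B))%E.
Proof.
move=> mA mB PA PB.
have PC (D : set T) (u : R) : measurable D -> ((1 - u)%:E <= P D)%E ->
    (P (~` D) <= u%:E)%E.
  move=> mD PD; rewrite probability_setC//.
  by rewrite leeBlDr ?fin_num_measure// -leeBlDl// -EFinB.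
rewrite -[A `&` B]setCK probability_setC; last exact/measurableC/measurableI.
rewrite EFinB leeB// setCI EFinD.
have mU := measureU2 P (measurableC mA) (measurableC mB) : (P _ <= _)%E.
by rewrite (le_trans mU)// leeD// PC.
Qed.

End good_sample.

Theorem theorem2p2 (R : realType) :
  exists (C c0 : R -> R -> R -> R) (c1 : R -> R -> R),
    [/\ forall m sigma beta : R, 0 < C m sigma beta,
        forall m sigma beta : R, 0 < c0 m sigma beta,
        forall M sigma : R, 0 < c1 M sigma &
    forall (beta : R) (psi1 psi2 : R -> R) (M : R),
      1 < beta -> beta <= 2 ->
      catoni_type 2 psi1 -> catoni_type beta psi2 ->
      0 < M -> regular_with M psi1 ->
    forall (mu sigma m eps : R), 0 < sigma -> 0 < eps -> eps < 1 / 6 ->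
    forall (d : measure_display) (T : measurableType d) (P : probability T R)
      (n : nat) (X : 'I_n -> {RV P >-> R}),
      iid X ->
      (forall i : 'I_n, 'E_P[X i] = mu%:E)%E ->
      (forall i : 'I_n,
        'E_P[fun w : T => (`|X i w - mu| ^+ 2)%R] = (sigma ^+ 2)%:E)%E ->
      (forall i : 'I_n,
        'E_P[fun w : T => (`|X i w - mu| `^ (2 * beta))%R] = m%:E)%E ->
      C m sigma beta * (ln eps^-1 + 1) <= n%:R ->
      (* the base of the power in the upper bound on v is positive *)
      0 < 1 - c0 m sigma beta * rate beta n eps /\
      with_probability_at_least P (1 - 6 * eps)
        [set w : T | exists theta v : R,
          [/\ 0 < v,
              f1 psi1 eps (fun i => X i w) theta v = 0,
              f2 psi2 beta eps (fun i => X i w) theta v = 0,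
              `|theta - mu| <= sigma * (1 + c1 M sigma * rate beta n eps)
                               * Num.sqrt (2 * ln eps^-1 / n%:R) &
              (1 + c0 m sigma beta * rate beta n eps) `^ (- (1 / 2)) * sigma
                <= v <=
              (1 - c0 m sigma beta * rate beta n eps) `^ (- (1 / 2)) * sigma]]].
Proof.
(* [rho `^ (beta - 1)] will be at most [B^-1]: the first term of [B] serves
   [location_budget], the second one ensures [c0 * rho <= beta - 1]. *)
pose c0 (m sigma beta : R) := 49 + 16 * (`|m| / sigma `^ (2 * beta)).
pose B (m sigma beta : R) :=
  100 ^+ 3 * c0 m sigma beta ^+ 2 + c0 m sigma beta / `|beta - 1|.
have c0ge (m sigma beta : R) : 49 <= c0 m sigma beta.
  by rewrite /c0 lerDl mulr_ge0// divr_ge0// powR_ge0.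
have c0gt0 (m sigma beta : R) : 0 < c0 m sigma beta.
  by rewrite (lt_le_trans _ (c0ge _ _ _)).
have Bge (m sigma beta : R) : 100 ^+ 3 * c0 m sigma beta ^+ 2 <= B m sigma beta.
  by rewrite lerDl divr_ge0// ltW.
have Bgt0 (m sigma beta : R) : 0 < B m sigma beta.
  by rewrite (lt_le_trans _ (Bge _ _ _))// mulr_gt0// exprn_gt0.
exists (fun m sigma beta => B m sigma beta `^ (beta / (beta - 1) ^+ 2)), c0, (fun _ _ => 1).
split => //.
  by move=> m sigma beta; exact: powR_gt0.
move=> beta psi1 psi2 M b1 b2 [cont1 mono1 _ env1] [cont2 mono2 _ env2] _ _.
move=> mu sigma m eps s0 eps0 eps6 d T P n X [indX _] EX E2 Eb nC.
pose L := ln eps^-1.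
have L0 : 0 < L by rewrite ln_gt0// invf_gt1//; lra.
set C := _ `^ _ in nC.
have C0 : 0 < C by exact: powR_gt0.
have n0 : 0 < n%:R :> R by rewrite (lt_le_trans _ nC)// mulr_gt0// addr_gt0.
pose r := L / n%:R.
have r0 : 0 < r by rewrite divr_gt0.
have nr : n%:R * r = L by rewrite mulrC divfK// gt_eqF.
have rC : r * C <= 1.
  rewrite mulrAC ler_pdivrMr// mul1r (le_trans _ nC)// mulrC ler_wpM2l ?(ltW C0)//.
  by rewrite lerDl.
have m0 : 0 <= m.
  have i0 : 'I_n by apply: (@Ordinal n 0); move: n0; rewrite ltr0n.
  rewrite -lee_fin -(Eb i0); apply: expectation_ge0 => w; exact: powR_ge0.
have s2b0 : 0 < sigma `^ (2 * beta) by exact: powR_gt0.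
pose ms := m / sigma `^ (2 * beta).
have ms0 : 0 <= ms by rewrite divr_ge0// ltW.
set c := c0 m sigma beta.
have cE : c = 49 + 16 * ms by rewrite /c /c0 ger0_norm.
have B1 : 1 <= B m sigma beta.
  apply: le_trans (Bge _ _ _); rewrite mulr_ege1// exprn_ege1//; first by rewrite ler1n.
  by rewrite (le_trans _ (c0ge _ _ _))//; lra.
have [[rho0 al0 alrho alrhoE alb] [rhow wB r2b]] := rate_facts _ _ _ _ b1 b2 B1 r0 rC.
set rho := r `^ ((beta - 1) / beta) in rho0 alrho alrhoE rhow wB r2b.
set al := r `^ beta^-1 in al0 alrho alrhoE alb.
set w := rho `^ (beta - 1) in rhow wB r2b.
rewrite -/c /rate -/L -/r -/rho.
have c_gt0 : 0 < c by exact: c0gt0.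
have rhoB : rho * B m sigma beta <= 1.
  by rewrite -ler_pdivlMr// mul1r (le_trans rhow).
have w0 : 0 < w by exact: lt_le_trans rhow.
have wc : w <= (100 ^+ 3 * c ^+ 2)^-1.
  rewrite (le_trans wB)// lef_pV2 ?posrE; [exact: Bge|exact: Bgt0|].
  by rewrite mulr_gt0// exprn_gt0.
pose delta := c * rho.
have delta0 : 0 <= delta by rewrite mulr_ge0 ?ltW.
have rho_mul K : K <= 100 ^+ 3 * c ^+ 2 -> rho * K <= 1.
  move=> Kle; rewrite (le_trans _ rhoB)// ler_wpM2l ?(ltW rho0)//.
  by rewrite (le_trans Kle)// Bge.
have c49 : 49 <= c by exact: c0ge.
have K_le (K : R) : K <= 49 -> K * c <= 100 ^+ 3 * c ^+ 2.
  move=> K49; rewrite expr2 mulrA ler_wpM2r ?(ltW c_gt0)//.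
  rewrite (le_trans K49)// (le_trans c49)// ler_peMl ?(ltW c_gt0)//.
  by rewrite exprn_ege1// ler1n.
have delta_small : delta <= 2^-1.
  rewrite -[leRHS]mul1r ler_pdivlMr// (_ : delta * 2 = rho * (2 * c));
    last by rewrite /delta; ring.
  apply: rho_mul.
  by apply: K_le; rewrite ler_nat.
have delta_b : delta <= beta - 1.
  have b10 : 0 < beta - 1 by rewrite subr_gt0.
  rewrite -[leRHS]mul1r -ler_pdivrMr// /delta mulrAC mulrC (le_trans _ rhoB)//.
  rewrite ler_wpM2l ?(ltW rho0)// /B -/c gtr0_norm// lerDr.
  by rewrite mulr_ge0 ?sqr_ge0// exprn_ge0.
have rho1 : rho <= 3^-1.
  rewrite -[leRHS]mul1r ler_pdivlMr//; apply: rho_mul.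
  apply: le_trans (K_le 1 _); last by rewrite ler1n.
  by rewrite mul1r (le_trans _ c49)// ler_nat.
pose a := alpha1 n eps.
have a2 : a ^+ 2 = 2 * r by rewrite sqr_sqrtr ?divr_ge0 ?mulr_ge0 ?(ltW L0)// -mulrA.
have a0 : 0 < a by rewrite sqrtr_gt0 divr_gt0 ?mulr_gt0.
have rr : r <= rho ^+ 2 by rewrite -alrhoE expr2 ler_wpM2r ?(ltW rho0).
have arho : a <= 3 / 2 * rho.
  rewrite -ler_sqr ?nnegrE ?(ltW a0) ?mulr_ge0 ?(ltW rho0)// a2 exprMn.
  by move: rr (sqr_ge0 rho); clear; lra.
pose kappa := a * (1 + rho).
have kappa0 : 0 < kappa by rewrite mulr_gt0// addr_gt0.
have kappa3 : kappa <= 3 * rho.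
  have -> : 3 * rho = 3 / 2 * rho * 2 by field.
  apply: ler_pM; rewrite ?(ltW a0) ?addr_ge0 ?(ltW rho0)//.
  by move: rho1; clear; lra.
have kappa1 : kappa <= 1.
  by rewrite (le_trans kappa3)//; move: rho1; lra.
have h0 : 0 <= kappa * sigma by rewrite mulr_ge0 ?ltW.
have hs : kappa * sigma <= sigma by rewrite ler_piMl// ltW.
pose A := a / sigma.
have A0 : 0 <= A by rewrite divr_ge0 ?ltW.
have As : A * sigma = a by rewrite divfK// gt_eqF.
have a2b : A `^ (2 * beta) * sigma `^ (2 * beta) = (2 * r) `^ beta.
  by rewrite -powRM// ?(ltW s0)// As -a2 powRrM powR_mulrn// ltW.
have mE : m = ms * sigma `^ (2 * beta) by rewrite divfK// gt_eqF.
have budget1 : n%:R * (1 - A * (kappa * sigma) +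
     (2^-1 + 352 * delta ^+ 2) * (A * (kappa * sigma)) ^+ 2 +
     5632 * A `^ (2 * beta) * sigma `^ (2 * beta) +
    (2^-1 + 352 * delta ^+ 2) * A ^+ 2 * sigma ^+ 2 +
    5632 * A `^ (2 * beta) * m - 1) + ln eps^-1 <= 0.
  have akE : a * kappa = 2 * r * (1 + rho) by rewrite /kappa mulrA -expr2 a2.
  apply: (sample_budget _ _ r _ _ (ltW n0) nr).
  have Ah : A * (kappa * sigma) = a * kappa by rewrite mulrCA As mulrC.
  have A2 : A ^+ 2 * sigma ^+ 2 = 2 * r by rewrite -exprMn As.
  rewrite (location_budgetE _ _ _ _ _ _ _ _ _ _ _ _ _ Ah A2 a2b mE).
  exact: (location_budget R r rho w c ms _ _ r0 rho0 rhow wc rr ms0 cE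
    (powR_ge0 _ _) r2b akE).
have env1' x : psi1 x <= ln (1 + x + `|x| `^ 2 / 2) by have /andP[] := env1 x.
have env1N x : - psi1 (- x) <= ln (1 + x + `|x| `^ 2 / 2).
  by have /andP[+ _] := env1 (- x); rewrite opprK normrN lerNl.
have env2' x : psi2 x <= ln (1 + x + `|x| `^ beta / beta) by have /andP[] := env2 x.
have env2N x : - psi2 (- x) <= ln (1 + x + `|x| `^ beta / beta).
  by have /andP[+ _] := env2 (- x); rewrite opprK normrN lerNl.
have sqN1 : (- 1 : R) ^+ 2 = 1 by rewrite sqrrN expr1n.
have [E1 [mE1 PE1 hE1]] := location_event _ _ _ P n X mu sigma m beta eps
  indX b1 b2 eps0 EX E2 Eb psi1 1 A (kappa * sigma) delta env1' (expr1n _ _)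
  A0 h0 hs delta0 delta_small delta_b budget1.
have [E1' [mE1' PE1' hE1']] := location_event _ _ _ P n X mu sigma m beta eps
  indX b1 b2 eps0 EX E2 Eb (fun x => - psi1 (- x)) (-1) A (kappa * sigma) delta env1N
  sqN1 A0 h0 hs delta0 delta_small delta_b budget1.
have s20 : 0 < sigma ^+ 2 by rewrite exprn_gt0.
have sn0 : sigma != 0 by rewrite gt_eqF.
have s2bn0 : sigma `^ (2 * beta) != 0 by rewrite gt_eqF.
have Y0 y : 0 <= y ^+ 2 / sigma ^+ 2 by rewrite divr_ge0 ?sqr_ge0.
have u0 : 0 <= (1 + kappa) * (1 - delta) <= 2.
  by move: kappa0 kappa1 delta0 delta_small; clear; nra.
have l0 : 0 <= (1 - kappa) * (1 + delta) <= 2.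
  by move: kappa0 kappa1 delta0 delta_small; clear; nra.
have k01 : 0 <= kappa <= 1 by rewrite (ltW kappa0).
have bound3 (y : R) : `|(1 + kappa) * (1 - delta) / sigma ^+ 2 * y ^+ 2 +
    ((1 + kappa) * kappa * (1 - delta) - 1)| <= 2 * (y ^+ 2 / sigma ^+ 2) + 3.
  by rewrite [(1 + kappa) * kappa * _]mulrAC; exact: norm_affine_le_upper.
have bound4 (y : R) : `|- ((1 - kappa) * (1 + delta)) / sigma ^+ 2 * y ^+ 2 +
    ((1 - kappa) * kappa * (1 + delta) + 1)| <= 2 * (y ^+ 2 / sigma ^+ 2) + 3.
  by rewrite [(1 - kappa) * kappa * _]mulrAC; exact: norm_affine_le_lower.
have delta1 : delta <= 1 by move: delta_small; clear; lra.
have budget3 : n%:R * (1 + al * ((1 + kappa) * kappa * (1 - delta) - 1) + 36 * r +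
    al * ((1 + kappa) * (1 - delta) / sigma ^+ 2) * sigma ^+ 2 +
    r * (16 / sigma `^ (2 * beta)) * m - 1) + ln eps^-1 <= 0.
  apply: (sample_budget _ _ r _ _ (ltW n0) nr).
  rewrite (scale_budgetE _ _ _ _ _ _ _ _ _ _ _ _ (divfK (lt0r_neq0 s20) _) mE s2bn0).
  have := scale_budget_upper _ al rho c ms kappa al0 rho0 (ltW kappa0)
    kappa3 kappa1 ms0 cE delta1.
  rewrite alrhoE -/delta.
  have -> : (1 + kappa) * (1 - delta) + ((1 + kappa) * kappa * (1 - delta) - 1) =
    (1 + kappa) ^+ 2 * (1 - delta) - 1 by ring.
  exact: id.
have budget4 : n%:R * (1 + al * ((1 - kappa) * kappa * (1 + delta) + 1) + 36 * r +
    al * (- ((1 - kappa) * (1 + delta)) / sigma ^+ 2) * sigma ^+ 2 +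
    r * (16 / sigma `^ (2 * beta)) * m - 1) + ln eps^-1 <= 0.
  apply: (sample_budget _ _ r _ _ (ltW n0) nr).
  rewrite (scale_budgetE _ _ _ _ _ _ _ _ _ _ _ _ (divfK (lt0r_neq0 s20) _) mE s2bn0).
  have := scale_budget_lower _ al rho c ms kappa al0 rho0 (ltW kappa0)
    kappa3 kappa1 ms0 cE delta1.
  rewrite alrhoE -/delta.
  have -> : - ((1 - kappa) * (1 + delta)) + ((1 - kappa) * kappa * (1 + delta) + 1) =
    - ((1 - kappa) ^+ 2 * (1 + delta) - 1) by ring.
  by rewrite mulrN.
have [E3 [mE3 PE3 hE3]] := scale_event _ _ _ P n X mu sigma m beta eps
  indX s0 b1 b2 eps0 EX E2 Eb psi2 al r ((1 + kappa) * (1 - delta) / sigma ^+ 2)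
  ((1 + kappa) * kappa * (1 - delta) - 1)
  env2' al0 alb bound3 budget3.
have [E4 [mE4 PE4 hE4]] := scale_event _ _ _ P n X mu sigma m beta eps
  indX s0 b1 b2 eps0 EX E2 Eb (fun x => - psi2 (- x)) al r
  (- ((1 - kappa) * (1 + delta)) / sigma ^+ 2) ((1 - kappa) * kappa * (1 + delta) + 1)
  env2N al0 alb bound4 budget4.
split; first by rewrite subr_gt0 -/delta (le_lt_trans delta_small)// invf_lt1// ltr1n.
exists ((E1 `&` E1') `&` (E3 `&` E4)); split.
- by apply: measurableI; exact: measurableI.
- move=> u [[u1 u2] [u3 u4]] /=.
  have up1 lam : `|lam - 1| <= delta ->
      \sum_(i < n) psi1 (A * (X i u - mu - kappa * sigma) / lam) <= 0.
    by move=> /(hE1 u u1); under eq_bigr do rewrite mul1r.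
  have low1 lam : `|lam - 1| <= delta ->
      0 <= \sum_(i < n) psi1 (A * (X i u - mu + kappa * sigma) / lam).
    move=> /(hE1' u u2); rewrite sumrN oppr_le0.
    have argN i : - (A * (-1 * (X i u - mu) - kappa * sigma) / lam) =
        A * (X i u - mu + kappa * sigma) / lam by ring.
    by under eq_bigr do rewrite argN.
  have low2 : 0 <= \sum_(i < n) psi2 (al * ((1 - kappa) * (1 + delta) / sigma ^+ 2 *
      (X i u - mu) ^+ 2 - ((1 - kappa) * kappa * (1 + delta) + 1))).
    have := hE4 u u4; rewrite sumrN oppr_le0.
    have argN i : - (al * (- ((1 - kappa) * (1 + delta)) / sigma ^+ 2 * (X i u - mu) ^+ 2 +
        ((1 - kappa) * kappa * (1 + delta) + 1))) =
      al * ((1 - kappa) * (1 + delta) / sigma ^+ 2 * (X i u - mu) ^+ 2 -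
        ((1 - kappa) * kappa * (1 + delta) + 1)) by ring.
    by under eq_bigr do rewrite argN.
  have [t [v [tI vI F0 G0]]] := solution_of_score_bounds _ psi1 psi2 beta eps n
    (fun i => X i u) mu sigma kappa delta cont1 cont2 mono1 mono2 s0 kappa0
    kappa1 delta0 delta_small up1 low1 (hE3 u u3) low2.
  exists t, v; split => //.
  - move: vI => /andP[vI _]; rewrite (lt_le_trans _ vI)// mulr_gt0// powR_gt0//.
    by rewrite addr_gt0// mulr_gt0.
  - rewrite (le_trans tI)// mul1r (_ : Num.sqrt _ = a)//.
    by rewrite le_eqVlt; apply/orP; left; apply/eqP; rewrite /kappa; ring.
- have PE := prob_setI_ge _ _ _ P _ _ _ _
    (measurableI _ _ mE1 mE1') (measurableI _ _ mE3 mE4)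
    (prob_setI_ge _ _ _ P _ _ _ _ mE1 mE1' PE1 PE1')
    (prob_setI_ge _ _ _ P _ _ _ _ mE3 mE4 PE3 PE4).
  apply: le_trans PE; rewrite lee_fin; move: eps0; clear; lra.
Qed.
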